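(* Let $(u,T)\in V\times D$ be a solution of the non-isothermal flow system, and let $(\tilde u^{k+1},\tilde T^{k+1}),(u^{k+1},T^{k+1})\in V\times D$, $k\ge0$, be iterates of the Picard-Newton iteration started from some $(u^0,T^0)\in X\times D$. Assume $R_iC_p^2\nu^{-1}<1$ and that for every $k\ge0$ $$\beta_k:=\alpha_1+\alpha_2+C_s(\alpha_1+\alpha_2)\,[\kappa^{-1}+\nu^{-1}]\,\|\nabla(u-u^k)\|<1 .$$ If for some $k=k_0\ge0$ the iterate $u^{k}$ satisfies $$(1-\max\{\beta_k,R_iC_p^2\nu^{-1}\})^{-1}C_s(\alpha_1+\alpha_2)^2(\nu^{-1}+\kappa^{-1})\|\nabla(u-u^k)\|<1,$$ then the Picard-Newton iterates converge quadratically to $(u,T)$.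
   Context: Setting. $\Omega\subset\mathbb{R}^d$ ($d=2$ or $3$) is a bounded connected domain, sufficiently regular for the inequalities below, with $\partial\Omega=\Gamma_1\cup\Gamma_2$, $\mathrm{meas}(\Gamma_1\cap\Gamma_2)=0$, $\mathrm{meas}(\Gamma_1)>0$. $(\cdot,\cdot)$ and $\|\cdot\|$ are the $L^2(\Omega)$ inner product and norm (also dual pairings). $X=\{v\in H^1(\Omega)^d: v=0 \text{ on }\partial\Omega\}$, $Q=\{q\in L^2(\Omega):\int_\Omega q=0\}$, $D=\{w\in H^1(\Omega): w=0\text{ on }\Gamma_1\}$, $V=\{v\in X:(\nabla\cdot v,q)=0\ \forall q\in Q\}$; these spaces ($X$, $V$, $D$) are normed by $z\mapsto\|\nabla z\|$. Dual norms: $\|F\|_{V^*}=\sup_{0\ne z\in V}(F,z)/\|\nabla z\|$, and similarly $\|\cdot\|_{D^*}$. $C_p>0$ is a Poincaré constant: $\|z\|\le C_p\|\nabla z\|$ for all $z\in X$ and all $z\in D$. Trilinear forms: $b(u,v,w)=(u\cdot\nabla v,w)+\frac12((\nabla\cdot u)v,w)$ for $u,v,w\in X$ and $\hat b(u,s,t)=(u\cdot\nabla s,t)+\frac12((\nabla\cdot u)s,t)$ for $u\in X$, $s,t\in D$; they satisfy $b(u,v,v)=0$, $\hat b(u,s,s)=0$. $C_s>0$ is a constant with $|b(u,v,w)|\le C_s\|\nabla u\|\|\nabla v\|\|\nabla w\|$ and $|\hat b(u,s,t)|\le C_s\|\nabla u\|\|\nabla s\|\|\nabla t\|$. Data: $\nu,\kappa,R_i>0$,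 $f\in X^*$ (also regarded in $V^*$), $g\in D^*$. For scalar $T$, $(0\ T)^T$ denotes the vector field whose last component is $T$ and whose other components are $0$. Non-isothermal flow system (weak form): $(u,T)\in V\times D$ with, for all $(v,w)\in V\times D$, $b(u,u,v)+\nu(\nabla u,\nabla v)=(f,v)+R_i((0\ T)^T,v)$ and $\hat b(u,T,w)+\kappa(\nabla T,\nabla w)=(g,w)$. Constants: $M_2=\kappa^{-1}\|g\|_{D^*}$, $M_1=\nu^{-1}\|f\|_{V^*}+R_iC_p^2\nu^{-1}M_2$, $\alpha_1=C_s\nu^{-1}M_1$, $\alpha_2=C_s\kappa^{-1}M_2$. Picard-Newton iteration. Given $u^k$: Step 1 (Picard step): $(\tilde u^{k+1},\tilde T^{k+1})\in V\times D$ satisfies, for all $(v,w)\in V\times D$, $b(u^k,\tilde u^{k+1},v)+\nu(\nabla\tilde u^{k+1},\nabla v)=(f,v)+R_i((0\ \tilde T^{k+1})^T,v)$ and $\hat b(u^k,\tilde T^{k+1},w)+\kappa(\nabla\tilde T^{k+1},\nabla w)=(g,w)$. Step 2 (Newton step): $(u^{k+1},T^{k+1})\in V\times D$ satisfies, for all $(v,w)\in V\times D$, $b(u^{k+1},\tilde u^{k+1},v)+b(\tilde u^{k+1},u^{k+1},v)+\nu(\nabla u^{k+1},\nabla v)=(f,v)+R_i((0\ T^{k+1})^T,v)+b(\tilde u^{k+1},\tilde u^{k+1},v)$ and $\hat b(u^{k+1},\tilde T^{k+1},w)+\hat b(\tilde u^{k+1},T^{k+1},w)+\kappa(\nabla T^{k+1},\nabla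 w)=(g,w)+\hat b(\tilde u^{k+1},\tilde T^{k+1},w)$. Quadratic convergence to $(u,T)$ means: with $E_k=\|\nabla(u-u^k)\|+\|\nabla(T-T^k)\|$, one has $E_k\to0$ as $k\to\infty$ and there is a constant $C$ independent of $k$ with $E_{k+1}\le C E_k^2$ for all $k\ge k_0$. *)

(* Defs.v *)
From HB Require Import structures.
From mathcomp Require Import all_boot all_order all_algebra.
From mathcomp Require Import all_classical all_reals all_analysis.
Set Implicit Arguments.
Unset Strict Implicit.
Unset Printing Implicit Defensive.
Import Order.TTheory GRing.Theory Num.Theory.
Import numFieldNormedType.Exports.
Local Open Scope classical_set_scope.
Local Open Scope ring_scope.

Definition rV_display : measure_display.
Proof. exact: default_measure_display. Qed.

Section measurable_rV.
Context (R : realType) (n : nat).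

Let coor : 'I_n -> 'rV[R]_n -> measurableTypeR R := fun i x => x ord0 i.

Let rV_set0 : g_sigma_preimage coor set0.
Proof. exact: sigma_algebra0. Qed.

Let rV_setC A : g_sigma_preimage coor A -> g_sigma_preimage coor (~` A).
Proof. exact: sigma_algebraC. Qed.

Let rV_bigcup (F : _^nat) : (forall i, g_sigma_preimage coor (F i)) ->
  g_sigma_preimage coor (\bigcup_i (F i)).
Proof. exact: sigma_algebra_bigcup. Qed.

HB.instance Definition _ := @isMeasurable.Build
  rV_display 'rV[R]_n
  (g_sigma_preimage coor) rV_set0 rV_setC rV_bigcup.
End measurable_rV.

Section lebesgue_rV.
Context (R : realType).

Definition rsnoc n (p : 'rV[R]_n * measurableTypeR R) : 'rV[R]_n.+1 :=
  \row_i if unlift ord_max i is Some j then p.1 ord0 j else p.2.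

Lemma measurable_rsnoc n : measurable_fun setT (@rsnoc n).
Proof.
apply: (@measurability _ _ _ _ setT (@rsnoc n) _ erefl) => A [B].
rewrite -bigcup_mkord_ord => -[k kn [C mC <-]] <-.
set i : 'I_n.+1 := inord k.
rewrite !setTI.
case: (unliftP ord_max i) => [j ij|ij].
  rewrite (_ : _ @^-1` _ = (fun p : 'rV[R]_n * measurableTypeR R => p.1 ord0 j) @^-1` C); last first.
    by apply/funext => p /=; rewrite /preimage/= mxE ij liftK.
  have mj : measurable_fun setT (fun x : 'rV[R]_n => x ord0 j : measurableTypeR R).
    move=> _ D mD; apply: sub_sigma_algebra; rewrite -bigcup_seq/=.
    by exists j => //=; [rewrite mem_index_enum|exists D].
  by rewrite -[X in measurable X]setTI; apply: (measurableT_comp mj measurable_fst).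
rewrite (_ : _ @^-1` _ = snd @^-1` C); last first.
  by apply/funext => p /=; rewrite /preimage/= mxE ij unlift_none.
by rewrite -[X in measurable X]setTI; apply: measurable_snd.
Qed.

Definition lebesgue_step n (m : {measure set 'rV[R]_n -> \bar R}) :
  {measure set 'rV[R]_n.+1 -> \bar R}.
Proof.
refine (pushforward (m \x @lebesgue_measure R)%E (@rsnoc n)
  : {measure set 'rV[R]_n.+1 -> \bar R}).
exact: measurable_rsnoc.
Defined.

Fixpoint lebesgue_rV n : {measure set 'rV[R]_n -> \bar R} :=
  if n is k.+1 then lebesgue_step (lebesgue_rV k) else dirac (0 : 'rV[R]_0).

Lemma lebesgue_rVS n (A : set 'rV[R]_n.+1) :
  lebesgue_rV n.+1 A =
  (lebesgue_rV n \x @lebesgue_measure R)%E (@rsnoc n @^-1` A).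
Proof. by []. Qed.
End lebesgue_rV.

Section surface_measure.
Context (R : realType) (d : nat).
Implicit Type A : set 'rV[R]_d.

(* The norm of the library on 'rV[R]_d is the sup norm. *)
Definition enorm (x : 'rV[R]_d) : R := Num.sqrt (\sum_(i < d) x ord0 i ^+ 2).

Definition diam A : \bar R :=
  maxe 0%E (ereal_sup [set (enorm (x - y))%:E | x in A & y in A]).

(* Hausdorff outer measure, without the usual normalisation constant, which is
   irrelevant below: only whether a set has measure zero is ever used. *)
Definition hausdorff (s : nat) A : \bar R :=
  ereal_sup [set ereal_inf [set (\sum_(0 <= k <oo) diam (U k) ^+ s)%E |
      U in [set U : nat -> set 'rV[R]_d | A `<=` \bigcup_k U k /\
                                forall k, (diam (U k) <= delta%:E)%E]] |
    delta in [set delta : R | 0 < delta]].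

Definition surface A : \bar R := hausdorff d.-1 A.

Definition bd A : set 'rV[R]_d := closure A `\` A°.

End surface_measure.

Section sobolev.
Context (R : realType) (d : nat) (Omega : set 'rV[R]_d).
Local Notation E := 'rV[R]_d.
Local Notation mu := (lebesgue_rV R d).

Definition partial (i : 'I_d) (f : E -> R) : E -> R :=
  fun x => 'D_(delta_mx ord0 i) f x.

Definition smooth (f : E -> R) : Prop := forall s : seq 'I_d,
  let h := foldr partial f s in
  continuous h /\ forall i x, derivable h x (delta_mx ord0 i).

Definition test_function (f : E -> R) : Prop :=
  smooth f /\
  exists K, [/\ compact K, K `<=` Omega & forall x, ~ K x -> f x = 0].

Definition L2 (f : E -> R) : Prop :=
  measurable_fun Omega f /\
  (\int[mu]_(x in Omega) ((f x) ^+ 2)%:E < +oo)%E.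

Definition ip (f g : E -> R) : R := \int[mu]_(x in Omega) (f x * g x).

(* Elements of H^1 are handled as pairs made of a function and its weak
   gradient, i.e. H^1 is the graph of the weak gradient in L^2 x (L^2)^d. Thus
   sums, differences and gradients of elements of H^1 are computed pointwise,
   and no choice of a representative of the weak gradient is needed. *)
Definition jet : Type := (E -> R) * ('I_d -> E -> R).
Definition vjet : Type := 'I_d -> jet.

Definition jet_of (f : E -> R) : jet := (f, fun i => partial i f).

Definition H1 (w : jet) : Prop :=
  [/\ L2 w.1, forall i, L2 (w.2 i) &
      forall phi, test_function phi ->
      forall i, ip w.1 (partial i phi) = - ip (w.2 i) phi].

Definition grad_ip (w z : jet) : R := \sum_(i < d) ip (w.2 i) (z.2 i).
Definition norm0 (w : jet) : R := Num.sqrt (ip w.1 w.1).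
Definition norm1 (w : jet) : R := Num.sqrt (grad_ip w w).
Definition H1norm (w : jet) : R := Num.sqrt (ip w.1 w.1 + grad_ip w w).

Definition vgrad_ip (v z : vjet) : R := \sum_(i < d) grad_ip (v i) (z i).
Definition vnorm0 (v : vjet) : R := Num.sqrt (\sum_(i < d) ip (v i).1 (v i).1).
Definition vnorm1 (v : vjet) : R := Num.sqrt (vgrad_ip v v).

(* H^1 functions vanishing on the whole boundary: closure of C_c^oo(Omega). *)
Definition H10 (w : jet) : Prop :=
  H1 w /\ forall eps, 0 < eps -> exists phi,
    [/\ test_function phi, H1 (jet_of phi) & H1norm (w - jet_of phi) < eps].

(* gamma is the trace of w: the limit of the boundary values of functions that
   are smooth up to the boundary and converge to w in H^1. Convergence almost
   everywhere on the boundary is equivalent here to convergence in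
   L^2(bd Omega), up to a subsequence, when the trace operator is bounded. *)
Definition has_trace (w : jet) (gamma : E -> R) : Prop :=
  exists phi : nat -> E -> R,
    [/\ forall n, smooth (phi n) /\ H1 (jet_of (phi n)),
        H1norm (w - jet_of (phi n)) @[n --> \oo] --> 0 &
        surface (bd Omega `&` ~` [set x | phi n x @[n --> \oo] --> gamma x]) = 0%E].

Definition vanishes_on (Gamma : set E) (w : jet) : Prop :=
  exists gamma, has_trace w gamma /\
    surface (Gamma `&` [set x | gamma x <> 0]) = 0%E.

Definition divergence (v : vjet) : E -> R := fun x => \sum_(i < d) (v i).2 i x.

Definition spaceX (v : vjet) : Prop := forall i, H10 (v i).

Definition spaceQ (q : E -> R) : Prop := L2 q /\ \int[mu]_(x in Omega) q x = 0.

Definition spaceV (v : vjet) : Prop :=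
  spaceX v /\ forall q, spaceQ q -> ip (divergence v) q = 0.

Definition spaceD (Gamma1 : set E) (w : jet) : Prop :=
  H1 w /\ vanishes_on Gamma1 w.

Definition is_dual (Z : lmodType R) (S : Z -> Prop) (nrm F : Z -> R) : Prop :=
  (forall a z z', S z -> S z' -> F (a *: z + z') = a * F z + F z') /\
  exists C, forall z, S z -> `|F z| <= C * nrm z.

(* nrm is a norm on S: its nonzero elements are those with nrm z != 0. *)
Definition dual_norm (Z : Type) (S : Z -> Prop) (nrm F : Z -> R) : R :=
  sup [set F z / nrm z | z in [set z | S z /\ nrm z != 0]].

Definition convection (u v w : vjet) : E -> R := fun x =>
  \sum_(j < d) (\sum_(i < d) (u i).1 x * (v j).2 i x) * (w j).1 x.
Definition div_term (u v w : vjet) : E -> R := fun x =>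
  \sum_(j < d) divergence u x * (v j).1 x * (w j).1 x.
Definition b (u v w : vjet) : R :=
  \int[mu]_(x in Omega) convection u v w x +
  2^-1 * \int[mu]_(x in Omega) div_term u v w x.

Definition hconvection (u : vjet) (s t : jet) : E -> R := fun x =>
  (\sum_(i < d) (u i).1 x * s.2 i x) * t.1 x.
Definition hdiv_term (u : vjet) (s t : jet) : E -> R := fun x =>
  divergence u x * s.1 x * t.1 x.
Definition bh (u : vjet) (s t : jet) : R :=
  \int[mu]_(x in Omega) hconvection u s t x +
  2^-1 * \int[mu]_(x in Omega) hdiv_term u s t x.

(* ((0 T)^T, v) *)
Definition buoyancy (T : jet) (v : vjet) : R :=
  \sum_(i < d) ip (fun x => if i.+1 == d then T.1 x else 0) (v i).1.

End sobolev.

Section scheme.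
Context (R : realType) (d : nat) (Omega Gamma1 : set 'rV[R]_d).
Context (nu kappa Ri : R) (f : vjet R d -> R) (g : jet R d -> R).
Local Notation V := (spaceV Omega).
Local Notation D := (spaceD Omega Gamma1).
Local Notation b := (b Omega).
Local Notation bh := (bh Omega).

Definition flow_solution (u : vjet R d) (T : jet R d) : Prop :=
  [/\ V u, D T & forall v w, V v -> D w ->
    b u u v + nu * vgrad_ip Omega u v = f v + Ri * buoyancy Omega T v /\
    bh u T w + kappa * grad_ip Omega T w = g w].

Definition picard_step (u ut : vjet R d) (Tt : jet R d) : Prop :=
  [/\ V ut, D Tt & forall v w, V v -> D w ->
    b u ut v + nu * vgrad_ip Omega ut v = f v + Ri * buoyancy Omega Tt v /\
    bh u Tt w + kappa * grad_ip Omega Tt w = g w].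

Definition newton_step (ut : vjet R d) (Tt : jet R d)
    (u : vjet R d) (T : jet R d) : Prop :=
  [/\ V u, D T & forall v w, V v -> D w ->
    b u ut v + b ut u v + nu * vgrad_ip Omega u v =
      f v + Ri * buoyancy Omega T v + b ut ut v /\
    bh u Tt w + bh ut T w + kappa * grad_ip Omega T w = g w + bh ut Tt w].

Definition M2 : R := kappa^-1 * dual_norm D (norm1 Omega) g.

Definition M1 (Cp : R) : R :=
  nu^-1 * dual_norm V (vnorm1 Omega) f + Ri * Cp ^+ 2 * nu^-1 * M2.

End scheme.

(* Main.v *)
Require Import Defs.
From HB Require Import structures.
From mathcomp Require Import all_boot all_order all_algebra.
From mathcomp Require Import all_classical all_reals all_analysis.
From mathcomp Require Import measurable_realfun ring lra.

(* Testing the Picard error equations with the errors themselves kills the terms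
   b(u^k, e, e) and bh(u^k, e, e), which leaves
   |grad(u - ut)| <= (alpha1 + alpha2) |grad(u - u^k)| and
   |grad(T - Tt)| <= alpha2 |grad(u - u^k)|.
   In the Newton error equation the residual is b(u - ut, u - ut, .), quadratic
   in the Picard error, while the linear terms are absorbed because
   alpha1 + alpha2 and Ri Cp^2 / nu are less than 1.
   For the skewness of b and bh, the velocity is replaced, by density, with
   test functions phi_i; then 2 phi_i s d_i s + (d_i phi_i) s^2 has integral 0
   because s is an H^1 limit of smooth functions psi (this is part of having a
   trace, or of belonging to H^1_0) and phi_i psi is a test function in the weak
   formula of s. *)

Set Implicit Arguments.
Unset Strict Implicit.
Unset Printing Implicit Defensive.
Import Order.TTheory GRing.Theory Num.Theory.
Import numFieldNormedType.Exports.
Local Open Scope classical_set_scope.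
Local Open Scope ring_scope.

(** * Semi-inner products on linear classes *)

Section semi_inner_product.
Context {R : realType}.
Implicit Types Z W : lmodType R.

(** The order of the two approximations behind skewness is forced. The bound with [Cs] holds only
    for arguments in X and D, and the smooth approximants of a temperature in D need not vanish on
    [Gamma1], so this bound cannot control the replacement of s. The velocity is therefore replaced
    first, with s fixed in D. Once the velocity is a test field, its coefficients are bounded, and s
    can be approximated in H^1 by Cauchy-Schwarz alone. The maximum in the final constant comes from
    adding the two Newton estimates: alpha1 (velocity estimate) and alpha2 (temperature estimate)
    both multiply the velocity error, while Ri Cp^2 / nu multiplies the temperature error. Both
    factors are at most the maximum, which is absorbed on the left. *)

Definition lin_closed Z (S : Z -> Prop) : Prop :=
  S 0 /\ forall c z z', S z -> S z' -> S (c *: z + z').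

(** Jets are functions, not classes modulo null sets, so definiteness fails; and integrals are
    additive only on integrable functions, so every law is relative to a predicate [S]. *)
Definition semi_ip Z (S : Z -> Prop) (a : Z -> Z -> R) : Prop :=
  [/\ lin_closed S,
      forall z w, S z -> S w -> a z w = a w z,
      forall c z z' w, S z -> S z' -> S w ->
        a (c *: z + z') w = c * a z w + a z' w &
      forall z, S z -> 0 <= a z z].

Lemma lin_closedZ Z (S : Z -> Prop) c z : lin_closed S -> S z -> S (c *: z).
Proof. by move=> [S0 SD] Sz; rewrite -[_ *: _]addr0; apply: SD. Qed.

Lemma lin_closedN Z (S : Z -> Prop) z : lin_closed S -> S z -> S (- z).
Proof. by move=> SD Sz; rewrite -scaleN1r; apply: lin_closedZ. Qed.

Lemma lin_closedD Z (S : Z -> Prop) z w : lin_closed S ->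
  S z -> S w -> S (z + w).
Proof. by move=> [S0 SD] Sz Sw; rewrite -[z]scale1r; apply: SD. Qed.

Lemma lin_closedB Z (S : Z -> Prop) z w : lin_closed S ->
  S z -> S w -> S (z - w).
Proof. by move=> SD Sz Sw; apply: lin_closedD => //; exact: lin_closedN. Qed.

Section theory.
Context {Z : lmodType R} {S : Z -> Prop} {a : Z -> Z -> R}.
Hypothesis aS : semi_ip S a.

Lemma semi_ip0l z : S z -> a 0 z = 0.
Proof.
case: aS => -[S0 _] _ aD _ Sz; have := aD 1 0 0 z S0 S0 Sz.
by rewrite scaler0 addr0 mul1r; lra.
Qed.

Lemma semi_ipZl c z w : S z -> S w -> a (c *: z) w = c * a z w.
Proof.
case: (aS) => -[S0 _] _ aD _ Sz Sw.
by rewrite -[c *: z]addr0 aD// semi_ip0l// addr0.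
Qed.

Lemma semi_ipDl z z' w : S z -> S z' -> S w -> a (z + z') w = a z w + a z' w.
Proof.
by case: aS => _ _ aD _ Sz Sz' Sw; rewrite -[z]scale1r aD// scale1r mul1r.
Qed.

Lemma semi_ipBl z z' w : S z -> S z' -> S w -> a (z - z') w = a z w - a z' w.
Proof.
move=> Sz Sz' Sw; case: (aS) => SD _ _ _.
rewrite semi_ipDl//; last exact: lin_closedN.
by rewrite -scaleN1r semi_ipZl// mulN1r.
Qed.

Lemma semi_ipE c z w : S z -> S w ->
  a (c *: z + w) (c *: z + w) = c ^+ 2 * a z z + 2 * c * a z w + a w w.
Proof.
move=> Sz Sw; case: (aS) => -[_ SD] sym aD _.
have Scw := SD c _ _ Sz Sw.
by rewrite aD// (sym z)// (sym w (_ + _))// !aD// (sym w z)//; ring.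
Qed.

Lemma semi_ip_CS z w : S z -> S w ->
  `|a z w| <= Num.sqrt (a z z) * Num.sqrt (a w w).
Proof.
move=> Sz Sw; case: (aS) => -[_ SD] _ _ a0.
have zz := a0 _ Sz; have ww := a0 _ Sw.
have pos c : 0 <= c ^+ 2 * a z z + 2 * c * a z w + a w w.
  by rewrite -semi_ipE//; apply/a0/SD.
suff H : a z w ^+ 2 <= a z z * a w w.
  by rewrite -sqrtrM// -sqrtr_sqr ler_sqrt// ?mulr_ge0.
have [z0|z0] := eqVneq (a z z) 0.
  have [->|n0] := eqVneq (a z w) 0; first by rewrite expr0n/= mulr_ge0.
  (* When [a z z = 0] the quadratic is affine in c, and this c gives it the value -1. *)
  have := pos (- (a w w + 1) / (2 * a z w)).
  have -> : 2 * (- (a w w + 1) / (2 * a z w)) * a z w = - (a w w + 1).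
    by field.
  by rewrite z0; lra.
have {}zz : 0 < a z z by rewrite lt_def z0.
(* The minimiser of the quadratic. *)
have := pos (- a z w / a z z).
have -> : (- a z w / a z z) ^+ 2 * a z z + 2 * (- a z w / a z z) * a z w + a w w
  = (a z z * a w w - a z w ^+ 2) / a z z by field.
by rewrite pmulr_lge0 ?invr_gt0// subr_ge0.
Qed.

Lemma semi_ip_sqr z : S z -> Num.sqrt (a z z) ^+ 2 = a z z.
Proof. by case: aS => _ _ _ a0 Sz; rewrite sqr_sqrtr// a0. Qed.

Lemma semi_ip_triangle z w : S z -> S w ->
  Num.sqrt (a (z + w) (z + w)) <= Num.sqrt (a z z) + Num.sqrt (a w w).
Proof.
move=> Sz Sw; case: (aS) => SD _ _ a0.
rewrite -[leRHS]ger0_norm ?addr_ge0 ?sqrtr_ge0// -sqrtr_sqr ler_sqrt ?sqr_ge0//.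
have := semi_ipE 1 Sz Sw; rewrite scale1r => ->.
rewrite sqrrD !semi_ip_sqr//.
have := ler_norm (a z w); have := semi_ip_CS Sz Sw.
by rewrite !expr1n -mulr_natl; lra.
Qed.

Lemma semi_ip_normZ c z : S z ->
  Num.sqrt (a (c *: z) (c *: z)) = `|c| * Num.sqrt (a z z).
Proof.
move=> Sz; case: (aS) => SD sym aD a0.
have Scz : S (c *: z) by apply: lin_closedZ.
rewrite semi_ipZl// sym// semi_ipZl// mulrA -expr2 sqrtrM ?sqr_ge0//.
by rewrite sqrtr_sqr.
Qed.

Lemma semi_ip_normN z : S z ->
  Num.sqrt (a (- z) (- z)) = Num.sqrt (a z z).
Proof.
by move=> Sz; rewrite -scaleN1r semi_ip_normZ// normrN normr1 mul1r.
Qed.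

End theory.

Lemma semi_ip_sub Z (S S' : Z -> Prop) a : semi_ip S a ->
  lin_closed S' -> (forall z, S' z -> S z) -> semi_ip S' a.
Proof.
move=> [SD sym aD a0] S'D sub; split=> //.
- by move=> z w /sub ? /sub; apply: sym.
- by move=> c z z' w /sub ? /sub ? /sub; apply: aD.
- by move=> z /sub /a0.
Qed.

(** With [L i] the i-th component, this lifts the L^2 product to gradients and to vector fields. *)
Lemma semi_ip_sum Z W (S : Z -> Prop) (S' : W -> Prop) (a : W -> W -> R)
    (I : finType) (L : I -> Z -> W) :
  semi_ip S' a -> lin_closed S ->
  (forall i c z z', L i (c *: z + z') = c *: L i z + L i z') ->
  (forall i z, S z -> S' (L i z)) ->
  semi_ip S (fun z w => \sum_i a (L i z) (L i w)).
Proof.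
move=> [S'D sym aD a0] SD LD LS; split => //.
- by move=> z w Sz Sw; apply: eq_bigr => i _; apply: sym; apply: LS.
- move=> c z z' w Sz Sz' Sw; rewrite mulr_sumr -big_split/=.
  by apply: eq_bigr => i _; rewrite LD aD//; apply: LS.
- by move=> z Sz; apply: sumr_ge0 => i _; apply/a0/LS.
Qed.

Lemma semi_ip_add Z (S : Z -> Prop) a a' : semi_ip S a -> semi_ip S a' ->
  semi_ip S (fun z w => a z w + a' z w).
Proof.
move=> [SD sym aD a0] [_ sym' aD' a0']; split=> //.
- by move=> z w Sz Sw; rewrite sym// sym'.
- by move=> c z z' w Sz Sz' Sw; rewrite aD// aD'//; ring.
- by move=> z Sz; rewrite addr_ge0// (a0, a0').
Qed.

(** The supremum ranges over elements of nonzero seminorm; on the others the bound in [is_dual]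
    forces [F z = 0]. The quotients carry no absolute value, so the lower bound is the upper one at
    [- z]. *)
Lemma dual_norm_le Z (S : Z -> Prop) a (F : Z -> R) z : semi_ip S a ->
  is_dual S (fun z => Num.sqrt (a z z)) F -> S z ->
  `|F z| <= dual_norm S (fun z => Num.sqrt (a z z)) F * Num.sqrt (a z z).
Proof.
move=> aS [Fl [C FC]] Sz.
have [SD _ _ _] := aS.
have [n0|n0] := eqVneq (Num.sqrt (a z z)) 0.
  by have := FC _ Sz; rewrite n0 !mulr0.
have npos : 0 < Num.sqrt (a z z) by rewrite lt_def n0 sqrtr_ge0.
have key w : S w -> Num.sqrt (a w w) != 0 ->
    F w <= dual_norm S (fun z => Num.sqrt (a z z)) F * Num.sqrt (a w w).
  move=> Sw w0; have wpos : 0 < Num.sqrt (a w w) by rewrite lt_def w0 sqrtr_ge0.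
  rewrite -ler_pdivrMr//; apply: ub_le_sup; last by exists w.
  exists C => _ [y [Sy y0] <-].
  have ypos : 0 < Num.sqrt (a y y) by rewrite lt_def y0 sqrtr_ge0.
  by rewrite ler_pdivrMr//; apply: le_trans (ler_norm _) (FC _ Sy).
have FN : F (- z) = - F z.
  have [S0 _] := SD.
  have F0 : F 0 = 0.
    by have := Fl 1 0 0 S0 S0; rewrite scaler0 addr0 mul1r; lra.
  by have := Fl (-1) z 0 Sz S0; rewrite scaleN1r addr0 F0 addr0 mulN1r.
rewrite ler_norml; apply/andP; split; last exact: key.
rewrite lerNl -FN -(semi_ip_normN aS Sz).
by apply: key; [exact: lin_closedN|rewrite (semi_ip_normN aS)].
Qed.

Lemma dual_norm_ge0 Z (S : Z -> Prop) a (F : Z -> R) : semi_ip S a ->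
  is_dual S (fun z => Num.sqrt (a z z)) F ->
  0 <= dual_norm S (fun z => Num.sqrt (a z z)) F.
Proof.
move=> aS dF; set A := dual_norm _ _ _.
have [[z [Sz z0]]|nex] := pselect (exists z, S z /\ Num.sqrt (a z z) != 0).
  have zpos : 0 < Num.sqrt (a z z) by rewrite lt_def z0 sqrtr_ge0.
  rewrite -(pmulr_lge0 _ zpos).
  exact: le_trans (normr_ge0 _) (dual_norm_le aS dF Sz).
(* If all seminorms vanish, the supremum is that of the empty set, which is 0 by convention. *)
rewrite /A /dual_norm (_ : [set _ | _ in _] = set0) ?sup0//.
by apply/seteqP; split=> // r [z Sz _]; case: nex; exists z.
Qed.

End semi_inner_product.

(** * Error estimates for abstract Picard-Newton iterations *)

Section picard_newton.
Context {R : realType}.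

Definition trilinear (A B C : lmodType R) (SA : A -> Prop) (SB : B -> Prop)
    (SC : C -> Prop) (t : A -> B -> C -> R) : Prop :=
  [/\ forall c x x' y z, SA x -> SA x' -> SB y -> SC z ->
        t (c *: x + x') y z = c * t x y z + t x' y z,
      forall c x y y' z, SA x -> SB y -> SB y' -> SC z ->
        t x (c *: y + y') z = c * t x y z + t x y' z &
      forall c x y z z', SA x -> SB y -> SC z -> SC z' ->
        t x y (c *: z + z') = c * t x y z + t x y z'].

Lemma trilinearBl (A B C : lmodType R) (SA : A -> Prop) (SB : B -> Prop)
    (SC : C -> Prop) t x x' y z :
  trilinear SA SB SC t -> SA x -> SA x' -> SB y -> SC z ->
  t (x - x') y z = t x y z - t x' y z.
Proof.
move=> [tl _ _] ? ? ? ?.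
by rewrite addrC -scaleN1r tl// mulN1r addrC.
Qed.

Lemma trilinearBm (A B C : lmodType R) (SA : A -> Prop) (SB : B -> Prop)
    (SC : C -> Prop) t x y y' z :
  trilinear SA SB SC t -> SA x -> SB y -> SB y' -> SC z ->
  t x (y - y') z = t x y z - t x y' z.
Proof.
move=> [_ tl _] ? ? ? ?.
by rewrite addrC -scaleN1r tl// mulN1r addrC.
Qed.

Context {U S : lmodType R} (X V : U -> Prop) (D : S -> Prop).
Context (aX : U -> U -> R) (aD : S -> S -> R).
Context (b : U -> U -> U -> R) (bh : U -> S -> S -> R) (buo : S -> U -> R).
Context (nu kappa Ri Cp Cs : R) (f : U -> R) (g : S -> R).

Let nX v := Num.sqrt (aX v v).
Let nD s := Num.sqrt (aD s s).

Hypotheses (aXP : semi_ip X aX) (aDP : semi_ip D aD).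
Hypotheses (Vlin : lin_closed V) (VX : forall v, V v -> X v).
Hypotheses (btri : trilinear X X X b) (bhtri : trilinear X D D bh).
Hypothesis b_le : forall u v w, X u -> X v -> X w ->
  `|b u v w| <= Cs * nX u * nX v * nX w.
Hypothesis bh_le : forall u s t, X u -> D s -> D t ->
  `|bh u s t| <= Cs * nX u * nD s * nD t.
Hypothesis b_skew : forall u v, X u -> X v -> b u v v = 0.
Hypothesis bh_skew : forall u s, X u -> D s -> bh u s s = 0.
Hypothesis buoB : forall s t v, D s -> D t -> X v ->
  buo (s - t) v = buo s v - buo t v.
Hypothesis buo_le : forall s v, D s -> X v ->
  `|buo s v| <= Cp ^+ 2 * nD s * nX v.
Hypotheses (Cs_gt0 : 0 < Cs) (Cp_gt0 : 0 < Cp).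
Hypotheses (nu_gt0 : 0 < nu) (kappa_gt0 : 0 < kappa) (Ri_gt0 : 0 < Ri).
Hypotheses (fP : is_dual V nX f) (gP : is_dual D nD g).

Let m2 := kappa^-1 * dual_norm D nD g.
Let m1 := nu^-1 * dual_norm V nX f + Ri * Cp ^+ 2 * nu^-1 * m2.
Let alpha1 := Cs * nu^-1 * m1.
Let alpha2 := Cs * kappa^-1 * m2.
Let lambda := Ri * Cp ^+ 2 * nu^-1.

Let nX_ge0 v : 0 <= nX v. Proof. exact: sqrtr_ge0. Qed.
Let nD_ge0 v : 0 <= nD v. Proof. exact: sqrtr_ge0. Qed.

Let aVP : semi_ip V aX. Proof. exact: semi_ip_sub aXP Vlin VX. Qed.

Let Xlin : lin_closed X. Proof. by case: aXP. Qed.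
Let Dlin : lin_closed D. Proof. by case: aDP. Qed.
Let VB v w : V v -> V w -> V (v - w). Proof. exact: lin_closedB. Qed.
Let XB v w : X v -> X w -> X (v - w). Proof. exact: lin_closedB. Qed.
Let DB v w : D v -> D w -> D (v - w). Proof. exact: lin_closedB. Qed.

Let m2_ge0 : 0 <= m2.
Proof.
by rewrite mulr_ge0 ?invr_ge0 ?(ltW kappa_gt0)//; exact: dual_norm_ge0 aDP gP.
Qed.

Let lambda_ge0 : 0 <= lambda.
Proof. by rewrite !mulr_ge0 ?exprn_ge0 ?invr_ge0// ?ltW. Qed.

Let m1_ge0 : 0 <= m1.
Proof.
apply: addr_ge0; last exact: (mulr_ge0 lambda_ge0 m2_ge0).
by rewrite mulr_ge0 ?invr_ge0 ?(ltW nu_gt0)//; exact: dual_norm_ge0 aVP fP.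
Qed.

Let Cs_ge0 : 0 <= Cs. Proof. exact: ltW. Qed.
Let Ri_ge0 : 0 <= Ri. Proof. exact: ltW. Qed.
Let Cp2_ge0 : 0 <= Cp ^+ 2. Proof. exact: sqr_ge0. Qed.
Let RC_ge0 : 0 <= Ri * Cp ^+ 2. Proof. exact: mulr_ge0. Qed.

Let alpha1_ge0 : 0 <= alpha1.
Proof. by apply: mulr_ge0 m1_ge0; rewrite mulr_ge0// invr_ge0 ltW. Qed.

Let alpha2_ge0 : 0 <= alpha2.
Proof. by apply: mulr_ge0 m2_ge0; rewrite mulr_ge0// invr_ge0 ltW. Qed.

(** Ends every energy estimate: the function tested with is the one being estimated, so its norm n
    occurs squared on the left and once on the right. The hypothesis [0 <= A] settles [n = 0], where
    one cannot divide. *)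
Lemma cancel_norm (c n A : R) : 0 < c -> 0 <= n -> 0 <= A ->
  c * n ^+ 2 <= A * n -> n <= c^-1 * A.
Proof.
move=> c0 n0 A0; rewrite expr2 mulrA.
have [->|nn0] := eqVneq n 0.
  by rewrite mulr_ge0// invr_ge0 ltW.
have np : 0 < n by rewrite lt_def nn0.
by rewrite ler_pM2r// -ler_pdivlMl.
Qed.

(** For [w = u] this is the flow system, so results for an arbitrary transporting field w cover both
    the exact solution and the Picard iterates. *)
Let picard (w u : U) (T : S) : Prop := [/\ V u, D T & forall v s, V v -> D s ->
  b w u v + nu * aX u v = f v + Ri * buo T v /\
  bh w T s + kappa * aD T s = g s].

Lemma picard_bound w u T : X w -> picard w u T -> nX u <= m1 /\ nD T <= m2.
Proof.
move=> Xw [Vu DT eqs]; have [eu eT] := eqs _ _ Vu DT.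
have nT : nD T <= m2.
  apply: cancel_norm => //; first exact: dual_norm_ge0 aDP gP.
  move: eT; rewrite bh_skew// add0r /nD (semi_ip_sqr aDP)// => ->.
  exact: le_trans (ler_norm _) (dual_norm_le aDP gP DT).
split=> //.
have Xu := VX Vu.
have -> : m1 = nu^-1 * (dual_norm V nX f + Ri * Cp ^+ 2 * m2).
  by rewrite /m1; ring.
apply: cancel_norm => //.
  apply: addr_ge0; first exact: dual_norm_ge0 aVP fP.
  exact: mulr_ge0 m2_ge0.
move: eu; rewrite b_skew// add0r /nX (semi_ip_sqr aXP)// => ->.
rewrite mulrDl; apply: lerD.
  exact: le_trans (ler_norm _) (dual_norm_le aVP fP Vu).
rewrite (_ : _ * nX u = Ri * (Cp ^+ 2 * m2 * nX u)); last by ring.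
apply: ler_wpM2l => //; apply: le_trans (ler_norm _) _.
by apply: le_trans (buo_le DT Xu) _; rewrite ler_wpM2r// ler_wpM2l.
Qed.

Context (u : U) (T : S) (flow : picard u u T).

(** With e = u - ut, b(u, u, e) - b(w, ut, e) = b(u - w, u, e) + b(w, e, e), and the last term
    vanishes. What remains involves the exact solution, whence the factors [m1] and [m2]. *)
Lemma picard_error w ut Tt : X w -> lambda < 1 -> picard w ut Tt ->
  nX (u - ut) <= (alpha1 + alpha2) * nX (u - w) /\
  nD (T - Tt) <= alpha2 * nX (u - w).
Proof.
move=> Xw lambda1 [Vut DTt eqs]; have [Vu DT eqs0] := flow.
have Xu := VX Vu; have Xut := VX Vut.
have Ve := VB Vu Vut; have De := DB DT DTt.
have Xe := VX Ve.
have [eu eT] := eqs _ _ Ve De; have [eu0 eT0] := eqs0 _ _ Ve De.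
have Xuw := XB Xu Xw.
have [nu0 nT0] := picard_bound Xu flow.
have nT : nD (T - Tt) <= alpha2 * nX (u - w).
  rewrite /alpha2 (_ : _ * _ = kappa^-1 * (Cs * nX (u - w) * m2)); last by ring.
  apply: cancel_norm => //; first exact: mulr_ge0 (mulr_ge0 _ _) _.
  rewrite /nD (semi_ip_sqr aDP)//.
  have := trilinearBl bhtri Xu Xw DT De.
  have := trilinearBm bhtri Xw DT DTt De.
  have := semi_ipBl aDP DT DTt De.
  rewrite bh_skew// => e1 e2 e3.
  have -> : kappa * aD (T - Tt) (T - Tt) = - bh (u - w) T (T - Tt).
    by rewrite e1 e3; lra.
  apply: le_trans (ler_norm _) _; rewrite normrN.
  apply: le_trans (bh_le _ _ _) _ => //.
  by rewrite ler_wpM2r// ler_wpM2l// mulr_ge0// ltW.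
split=> //.
have key : nX (u - ut) <=
    nu^-1 * (Cs * nX (u - w) * m1 + Ri * Cp ^+ 2 * nD (T - Tt)).
  apply: cancel_norm => //.
    apply: addr_ge0; last exact: mulr_ge0.
    exact: mulr_ge0 (mulr_ge0 _ _) _.
  rewrite /nX (semi_ip_sqr aXP)//.
  have := trilinearBl btri Xu Xw Xu Xe.
  have := trilinearBm btri Xw Xu Xut Xe.
  have := semi_ipBl aXP Xu Xut Xe.
  have := buoB DT DTt Xe.
  rewrite b_skew// => e0 e1 e2 e3.
  have -> : nu * aX (u - ut) (u - ut) =
      - b (u - w) u (u - ut) + Ri * buo (T - Tt) (u - ut).
    by rewrite e0 e1 e3; lra.
  rewrite mulrDl; apply: lerD.
    apply: le_trans (ler_norm _) _; rewrite normrN.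
    apply: le_trans (b_le _ _ _) _ => //.
    by rewrite ler_wpM2r// ler_wpM2l// mulr_ge0// ltW.
  rewrite -!mulrA ler_wpM2l//.
  apply: le_trans (ler_norm _) _.
  by apply: le_trans (buo_le _ _) _ => //; rewrite -!mulrA.
apply: le_trans key _.
have -> : nu^-1 * (Cs * nX (u - w) * m1 + Ri * Cp ^+ 2 * nD (T - Tt)) =
  alpha1 * nX (u - w) + lambda * nD (T - Tt) by rewrite /alpha1 /lambda; ring.
(* The condition [lambda < 1] serves here to drop [lambda] in front of the temperature error. *)
rewrite mulrDl lerD2l; apply: le_trans nT.
by rewrite ler_piMl// ltW.
Qed.

Let newton (ut : U) (Tt : S) (v : U) (s : S) : Prop :=
  [/\ V v, D s & forall w r, V w -> D r ->
    b v ut w + b ut v w + nu * aX v w = f w + Ri * buo s w + b ut ut w /\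
    bh v Tt r + bh ut s r + kappa * aD s r = g r + bh ut Tt r].

(** With e = u - v, the convection terms of the two systems differ by b(u - ut, u - ut, e) + b(u -
    v, ut, e) + b(ut, e, e). The last term vanishes, and the second is linear in the error with
    factor at most [Cs * m1], by the bound on the Picard iterate. The temperature equation splits in
    the same way. *)
Lemma newton_error ut Tt v s : V ut -> D Tt -> newton ut Tt v s ->
  nX ut <= m1 -> nD Tt <= m2 ->
  nX (u - v) <= Cs * nu^-1 * nX (u - ut) ^+ 2 + alpha1 * nX (u - v)
                + lambda * nD (T - s) /\
  nD (T - s) <= Cs * kappa^-1 * nX (u - ut) * nD (T - Tt)
                + alpha2 * nX (u - v).
Proof.
move=> Vut DTt [Vv Ds eqs] nut nTt; have [Vu DT eqs0] := flow.
have [Xu Xut Xv] := And3 (VX Vu) (VX Vut) (VX Vv).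
have Ve := VB Vu Vv; have De := DB DT Ds.
have Xe := VX Ve; have Xet := XB Xu Xut; have Det := DB DT DTt.
have [eu eT] := eqs _ _ Ve De; have [eu0 eT0] := eqs0 _ _ Ve De.
split.
  rewrite (_ : _ + _ = nu^-1 * (Cs * nX (u - ut) ^+ 2 + Cs * nX (u - v) * m1
      + Ri * Cp ^+ 2 * nD (T - s))); last by rewrite /alpha1 /lambda; ring.
  apply: cancel_norm => //.
    apply: addr_ge0; last exact: mulr_ge0.
    apply: addr_ge0; first by rewrite mulr_ge0// sqr_ge0.
    exact: mulr_ge0 (mulr_ge0 _ _) _.
  rewrite {1}/nX (semi_ip_sqr aXP)//.
  have e1 := trilinearBl btri Xu Xv Xut Xe.
  have e2 := trilinearBm btri Xut Xu Xv Xe.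
  have e3 := trilinearBl btri Xu Xut Xet Xe.
  have e4 := trilinearBm btri Xu Xu Xut Xe.
  have e5 := trilinearBm btri Xut Xu Xut Xe.
  have e6 := semi_ipBl aXP Xu Xv Xe.
  have e7 := buoB DT Ds Xe.
  rewrite b_skew// in e2.
  have -> : nu * aX (u - v) (u - v) = - b (u - ut) (u - ut) (u - v)
      - b (u - v) ut (u - v) + Ri * buo (T - s) (u - v).
    by rewrite e1 e3 e4 e5 e6 e7; lra.
  rewrite !mulrDl; apply: lerD; first apply: lerD.
  - apply: le_trans (ler_norm _) _; rewrite normrN.
    by apply: le_trans (b_le _ _ _) _ => //; rewrite expr2 !mulrA.
  - apply: le_trans (ler_norm _) _; rewrite normrN.
    apply: le_trans (b_le _ _ _) _ => //.
    by rewrite ler_wpM2r// ler_wpM2l// mulr_ge0// ltW.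
  - rewrite -!mulrA ler_wpM2l//.
    apply: le_trans (ler_norm _) _.
    by apply: le_trans (buo_le _ _) _ => //; rewrite -!mulrA.
rewrite (_ : _ + _ = kappa^-1 * (Cs * nX (u - ut) * nD (T - Tt)
    + Cs * nX (u - v) * m2)); last by rewrite /alpha2; ring.
apply: cancel_norm => //.
  by apply: addr_ge0; exact: mulr_ge0 (mulr_ge0 _ _) _.
rewrite {1}/nD (semi_ip_sqr aDP)//.
have e1 := trilinearBl bhtri Xu Xv DTt De.
have e2 := trilinearBm bhtri Xut DT Ds De.
have e3 := trilinearBl bhtri Xu Xut Det De.
have e4 := trilinearBm bhtri Xu DT DTt De.
have e5 := trilinearBm bhtri Xut DT DTt De.
have e6 := semi_ipBl aDP DT Ds De.
rewrite bh_skew// in e2.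
have -> : kappa * aD (T - s) (T - s) = - bh (u - ut) (T - Tt) (T - s)
    - bh (u - v) Tt (T - s).
  by rewrite e1 e3 e4 e5 e6; lra.
rewrite mulrDl; apply: lerD.
- apply: le_trans (ler_norm _) _; rewrite normrN.
  exact: bh_le.
- apply: le_trans (ler_norm _) _; rewrite normrN.
  apply: le_trans (bh_le _ _ _) _ => //.
  by rewrite ler_wpM2r// ler_wpM2l// mulr_ge0// ltW.
Qed.

Let err v s := nX (u - v) + nD (T - s).

(** Here [beta] is any number in [alpha1 + alpha2, 1), not tied to w, so that one value can serve
    for all steps of the iteration. *)
Lemma picard_newton_error w ut Tt v s beta : X w -> lambda < 1 ->
  alpha1 + alpha2 <= beta -> beta < 1 ->
  picard w ut Tt -> newton ut Tt v s ->
  err v s <= (1 - Num.max beta lambda)^-1 * Cs * (alpha1 + alpha2) ^+ 2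
             * (nu^-1 + kappa^-1) * nX (u - w) ^+ 2.
Proof.
move=> Xw l1 ab b1 pic newt.
have [nut nTt] := picard_bound Xw pic.
have [eut eTt] := picard_error Xw l1 pic.
have [Vut DTt _] := pic.
have [ev es] := newton_error Vut DTt newt nut nTt.
have M1 : Num.max beta lambda < 1 by rewrite gt_max b1.
have le_b : beta <= Num.max beta lambda by rewrite le_max lexx.
have le_l : lambda <= Num.max beta lambda by rewrite le_max lexx orbT.
set M := Num.max beta lambda in M1 le_b le_l *.
(* After multiplying by 1 - M and moving M times the error to the right, the goal follows from the
   sum of [ev] and [es]. *)
rewrite -!mulrA mulrC ler_pdivlMr ?subr_gt0// /err mulrBr mulr1 lerBlDr.
set e := nX (u - w) in eut eTt *.
have e0 : 0 <= e by exact: nX_ge0.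
have q1 : nX (u - ut) ^+ 2 <= (alpha1 + alpha2) ^+ 2 * e ^+ 2.
  by rewrite -exprMn ler_pXn2r// nnegrE// mulr_ge0// addr_ge0.
have q2 : nX (u - ut) * nD (T - Tt) <= (alpha1 + alpha2) ^+ 2 * e ^+ 2.
  rewrite -exprMn expr2; apply: ler_pM => //; apply: le_trans eTt _.
  by rewrite ler_wpM2r// lerDr.
have q3 : Cs * nu^-1 * nX (u - ut) ^+ 2 <=
          Cs * nu^-1 * ((alpha1 + alpha2) ^+ 2 * e ^+ 2).
  by rewrite ler_wpM2l// mulr_ge0 ?invr_ge0 ?ltW.
have q4 : Cs * kappa^-1 * nX (u - ut) * nD (T - Tt) <=
          Cs * kappa^-1 * ((alpha1 + alpha2) ^+ 2 * e ^+ 2).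
  by rewrite -[leLHS]mulrA ler_wpM2l// mulr_ge0 ?invr_ge0 ?ltW.
have q5 : (alpha1 + alpha2) * nX (u - v) <= M * nX (u - v).
  by rewrite ler_wpM2r// (le_trans ab).
have q6 : lambda * nD (T - s) <= M * nD (T - s) by rewrite ler_wpM2r.
rewrite (_ : Cs * _ = Cs * nu^-1 * ((alpha1 + alpha2) ^+ 2 * e ^+ 2) +
  Cs * kappa^-1 * ((alpha1 + alpha2) ^+ 2 * e ^+ 2)); last by ring.
lra.
Qed.

Context (uk utk : nat -> U) (Tk Ttk : nat -> S).
Let beta k := alpha1 + alpha2 +
  Cs * (alpha1 + alpha2) * (kappa^-1 + nu^-1) * nX (u - uk k).

(* Once the contraction condition holds at [k0], the velocity error decreases,
   so [beta k <= beta k0] for [k >= k0] and the constant of [k0] serves for all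
   later steps. *)
Lemma picard_newton_quadratic k0 : X (uk 0%N) ->
  (forall k, picard (uk k) (utk k.+1) (Ttk k.+1)) ->
  (forall k, newton (utk k.+1) (Ttk k.+1) (uk k.+1) (Tk k.+1)) ->
  lambda < 1 -> (forall k, beta k < 1) ->
  (1 - Num.max (beta k0) lambda)^-1 * Cs * (alpha1 + alpha2) ^+ 2
    * (nu^-1 + kappa^-1) * nX (u - uk k0) < 1 ->
  err (uk k) (Tk k) @[k --> \oo] --> 0 /\
  exists C : R, forall k, (k0 <= k)%N ->
    err (uk k.+1) (Tk k.+1) <= C * err (uk k) (Tk k) ^+ 2.
Proof.
move=> X0 pic newt l1 b1.
set C := (1 - _)^-1 * _ * _ * _; set q := C * _ => q1.
have Xk k : X (uk k).
  by case: k => // k; apply: VX; case: (newt k).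
(* This inequality is all that is asked of [beta k0], so the quadratic estimate with the constant
   [C] of step k0 holds at every k. *)
have ab0 : alpha1 + alpha2 <= beta k0.
  by rewrite /beta lerDl !mulr_ge0 ?addr_ge0 ?invr_ge0// ltW.
have quad k : err (uk k.+1) (Tk k.+1) <= C * nX (u - uk k) ^+ 2.
  exact: picard_newton_error (Xk k) l1 ab0 (b1 k0) (pic k) (newt k).
have C0 : 0 <= C.
  apply: mulr_ge0; last by rewrite addr_ge0// invr_ge0 ltW.
  rewrite mulr_ge0 ?sqr_ge0// mulr_ge0// invr_ge0 subr_ge0 ltW//.
  by rewrite gt_max b1.
have err0 k : 0 <= err (uk k) (Tk k) by rewrite addr_ge0.
have nXerr k : nX (u - uk k) <= err (uk k) (Tk k) by rewrite lerDl.
split; last first.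
  exists C => k _; apply: le_trans (quad k) _; rewrite ler_wpM2l//.
  by rewrite ler_pXn2r ?nnegrE.
have q0 : 0 <= q by rewrite mulr_ge0.
(* In [C * x ^+ 2] one factor x is bounded by its value at k0, which yields the ratio [q]. Only
   velocity errors enter on the right of [quad], so the temperature error follows one step later. *)
have decay n : nX (u - uk (n + k0)%N) <= q ^+ n * nX (u - uk k0).
  elim: n => [|n IH]; first by rewrite expr0 mul1r.
  rewrite addSn; apply: le_trans (nXerr _) _; apply: le_trans (quad _) _.
  rewrite expr2 mulrA exprS -(mulrA q); apply: ler_pM => //; first exact: mulr_ge0.
  rewrite /q ler_wpM2l// (le_trans IH)// ler_piMl// exprn_ile1//; exact: ltW.
have errle n : err (uk (n + k0).+1) (Tk (n + k0).+1) <=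
    C * nX (u - uk k0) ^+ 2 * q ^+ n.
  apply: le_trans (quad _) _; rewrite -mulrA ler_wpM2l//.
  rewrite expr2 expr2 -mulrA; apply: ler_pM => //.
    by rewrite (le_trans (decay n))// ler_piMl// exprn_ile1// ltW.
  by rewrite mulrC.
rewrite -(cvg_shiftn k0.+1).
apply: (@squeeze_cvgr _ _ _ _ (fun=> 0) (fun n => C * nX (u - uk k0) ^+ 2 * q ^+ n)).
- by near=> n; rewrite /= addnS errle err0.
- exact: cvg_cst.
- rewrite -[X in _ --> X](mulr0 (C * nX (u - uk k0) ^+ 2)).
  by apply: cvgMr; apply: cvg_expr; rewrite ger0_norm.
Unshelve. all: by end_near.
Qed.

End picard_newton.
(** * Lebesgue measure and smooth functions *)

Section measure_rV.
Context {R : realType}.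

Lemma measurable_coord n (j : 'I_n) :
  measurable_fun setT (fun x : 'rV[R]_n => x ord0 j : measurableTypeR R).
Proof.
move=> _ B mB; apply: sub_sigma_algebra; rewrite -bigcup_seq/=.
by exists j => //=; [rewrite mem_index_enum|exists B].
Qed.

Lemma measurable_coord_box n (I : 'I_n -> set (measurableTypeR R)) :
  (forall i, measurable (I i)) ->
  measurable [set x : 'rV[R]_n | forall i, I i (x ord0 i)].
Proof.
move=> mI; rewrite (_ : [set _ | _] =
  \bigcap_(i in setT) ((fun x : 'rV[R]_n => x ord0 i) @^-1` I i)); last first.
  by apply/seteqP; split=> x /= H i; [move=> _; exact: H|exact: (H i)].
apply: fin_bigcap_measurable => // i _.
by rewrite -[X in measurable X]setTI; exact: measurable_coord.
Qed.

(* Boxes with rational centers and radii form a countable base. *)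
Lemma open_measurable_rV n (O : set 'rV[R]_n) : open O -> measurable O.
Proof.
move=> oO.
pose F (q : 'rV[rat]_n * rat) : set 'rV[R]_n :=
  [set x | forall i, `]ratr (q.1 ord0 i) - ratr q.2,
                       ratr (q.1 ord0 i) + ratr q.2[%classic (x ord0 i)].
have mF q : measurable (F q).
  apply: (measurable_coord_box (I := fun i => `]ratr (q.1 ord0 i) - ratr q.2,
    ratr (q.1 ord0 i) + ratr q.2[%classic)) => i; exact: measurable_itv.
have -> : O = \bigcup_q (if pselect (F q `<=` O) then F q else set0).
  apply/seteqP; split=> x; last first.
    by move=> [q _]; case: pselect => // FO /FO.
  move=> Ox; have /nbhs_ballP[e /= e0 xeO] : nbhs x O by exact: open_nbhs_nbhs.
  (* The rational centre is chosen within r of x, so the box of radius r around it contains x and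
     stays within 2r < e of x. *)
  have /rat_in_itvoo[r] : (0 : R) < e / 2 by rewrite divr_gt0.
  rewrite in_itv/= => /andP[r0 re].
  have H i : {q : rat | ratr q \in `]x ord0 i - ratr r, x ord0 i + ratr r[}.
    have : x ord0 i - ratr r < x ord0 i + ratr r by lra.
    by move=> /rat_in_itvoo/cid[q Hq]; exists q.
  exists (\row_i sval (H i), r) => //; case: pselect => /= [_|].
    move=> i /=; rewrite mxE; case: (H i) => q /=; rewrite !in_itv/=.
    by move=> /andP[? ?]; apply/andP; split; lra.
  case=> y Fy; apply: xeO; split=> // i j; rewrite ord1.
  have := Fy j; rewrite /= mxE; case: (H j) => q /=; rewrite !in_itv/=.
  move=> /andP[? ?] /andP[? ?]; rewrite /ball/= ltr_norml.
  by apply/andP; split; lra.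
apply: countable_bigcupT_measurable => // q.
by case: pselect => ?; [exact: mF|exact: measurable0].
Qed.

Lemma continuous_measurable_rV n (D : set 'rV[R]_n) (f : 'rV[R]_n -> R) :
  continuous f -> measurable_fun D f.
Proof.
move=> /continuousP cf; apply: measurable_funTS.
move=> _; apply: (measurability _ (RGenOpens.measurableE R)) => //.
move=> _ [_ [a [b ->] <-]]; rewrite setTI.
by apply: open_measurable_rV; apply: cf; exact: interval_open.
Qed.

Let box n (M : R) : set 'rV[R]_n :=
  [set x | forall i, `[- M, M]%classic (x ord0 i)].

Let measurable_box n M : measurable (@box n M).
Proof.
by apply: (measurable_coord_box (I := fun=> `[- M, M]%classic)) => i.
Qed.

(** By induction on the dimension: [rsnoc] pulls a box back to the product of a box and an interval,
    whose measure is a product of finite ones. *)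
Lemma lebesgue_rV_box n (M : R) :
  (lebesgue_rV R n [set x : 'rV[R]_n | forall i,
     `[(- M)%R, M]%classic (x ord0 i)] < +oo)%E.
Proof.
elim: n => [|n IH].
  by rewrite /= diracE; case: (_ \in _); exact: ltry.
rewrite lebesgue_rVS.
have -> : @rsnoc R n @^-1` @box n.+1 M = @box n M `*` `[- M, M]%classic.
  apply/seteqP; split=> -[x y] /= H.
    split=> [i|]; first by have := H (lift ord_max i); rewrite mxE liftK.
    by have := H ord_max; rewrite mxE unlift_none.
  move=> i; rewrite mxE; case: unliftP => [j _|_]; first exact: H.1.
  exact: H.2.
rewrite product_measure1E//; last exact: measurable_box.
rewrite lte_mul_pinfty//.
  by rewrite ge0_fin_numE.
rewrite [ltLHS](lebesgue_measure_itv `[- M, M])/=; case: ifP => // _.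
by rewrite -EFinD ltry.
Qed.

Lemma coord_le_norm n (x : 'rV[R]_n) i : `|x ord0 i| <= `|x|.
Proof.
rewrite [leRHS]/Num.norm/= mx_normrE.
by apply/bigmax_geP; right => /=; exists (ord0, i).
Qed.

Lemma lebesgue_rV_bounded n (A : set 'rV[R]_n) :
  measurable A -> bounded_set A -> (lebesgue_rV R n A < +oo)%E.
Proof.
move=> mA [M [_ AM]]; apply: le_lt_trans (lebesgue_rV_box n (M + 1)).
apply: le_measure; rewrite ?inE//; first exact: measurable_box.
move=> x Ax i /=; rewrite in_itv/= -ler_norml.
apply: le_trans (coord_le_norm x i) _.
by apply: (AM (M + 1)) => //; rewrite ltrDl.
Qed.

(** The set A need not be closed, but f is continuous on the whole space, hence bounded on a closed
    ball containing A, which is compact. *)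
Lemma continuous_bounded_on n (A : set 'rV[R]_n) (f : 'rV[R]_n -> R) :
  bounded_set A -> continuous f ->
  exists2 M, 0 <= M & forall x, A x -> `|f x| <= M.
Proof.
move=> [N [_ AN]] cf.
pose B := [set x : 'rV[R]_n | `|x| <= N + 1].
have : compact (f @` B).
  apply: continuous_compact; first exact/continuous_subspaceT.
  apply: bounded_closed_compact.
    exists (N + 1); split; first exact: num_real.
    by move=> M NM x /= xN; rewrite (le_trans xN)// ltW.
  apply: (@closed_comp _ _ (fun x : 'rV[R]_n => `|x|) [set r | r <= N + 1]).
    by move=> x _; exact: norm_continuous.
  exact: closed_le.
move=> /compact_bounded[M [_ fM]]; exists (`|M| + 1) => // x Ax.
apply: (fM (`|M| + 1)); first by rewrite ltr_pwDr// ler_norm.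
by exists x => //; apply: (AN (N + 1)) => //; rewrite ltrDl.
Qed.

End measure_rV.

Section smooth_functions.
Context {R : realType} {d : nat}.
Local Notation E := 'rV[R]_d.
Implicit Types (f g : E -> R) (i : 'I_d).

(** [smooth] speaks of all iterated partial derivatives, so an invariant class stable under
    [partial] is what a proof of it requires. *)
Lemma smooth_coind (P : (E -> R) -> Prop) :
  (forall f, P f -> [/\ continuous f,
     forall i x, derivable f x (delta_mx ord0 i) & forall i, P (partial i f)]) ->
  forall f, P f -> smooth f.
Proof.
move=> HP f Pf s.
suff : P (foldr (@partial R d) f s) by move=> /HP[? ? _]; split.
elim: s => //= i s IH.
by case: (HP _ IH) => _ _; exact.
Qed.

Lemma smooth_continuous f : smooth f -> continuous f.
Proof. by move=> /(_ [::])[]. Qed.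

Lemma smooth_derivable f i x : smooth f -> derivable f x (delta_mx ord0 i).
Proof. by move=> /(_ [::])[_]; exact. Qed.

Lemma smooth_partial f i : smooth f -> smooth (partial i f).
Proof. by move=> sf s; have := sf (rcons s i); rewrite foldr_rcons. Qed.

Lemma partial_lin f g i c : smooth f -> smooth g ->
  partial i (c *: f + g) = c *: partial i f + partial i g.
Proof.
move=> sf sg; apply/funext => x; rewrite /partial.
have df : derivable f x (delta_mx ord0 i) by exact: smooth_derivable.
have dg : derivable g x (delta_mx ord0 i) by exact: smooth_derivable.
have dcf : derivable (c *: f) x (delta_mx ord0 i) by exact: derivableZ.
by rewrite deriveD// deriveZ.
Qed.

Lemma partial_mul f g i : smooth f -> smooth g ->
  partial i (f * g) = f * partial i g + partial i f * g.
Proof.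
move=> sf sg; apply/funext => x; rewrite /partial.
rewrite deriveM; [|exact: smooth_derivable..].
by rewrite -[g x *: _]mulrC.
Qed.

(** The invariant for [smooth_coind]: products alone are not stable under [partial], but by the
    Leibniz rule their sums are. *)
Inductive sum_of_products : (E -> R) -> Prop :=
| sop_mul f g : smooth f -> smooth g -> sum_of_products (f * g)
| sop_add f g : sum_of_products f -> sum_of_products g ->
    sum_of_products (f + g).

Lemma smooth_cst (c : R) : smooth (cst c : E -> R).
Proof.
apply: (smooth_coind (P := fun f => exists c, f = cst c)); last by exists c.
move=> _ [a ->]; split=> //.
- exact: cst_continuous.
- move=> i; exists 0; apply/funext => x.
  by rewrite /partial derive_cst.
Qed.

Lemma smooth_sum_of_products f : sum_of_products f -> smooth f.
Proof.
apply: smooth_coind => {}f.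
elim=> {f} [f g sf sg|f g _ [cf df pf] _ [cg dg pg]]; split.
- by move=> x; apply: continuousM; exact: smooth_continuous.
- by move=> i x; apply: derivableM; exact: smooth_derivable.
- move=> i; rewrite partial_mul//.
  by apply: sop_add; apply: sop_mul => //; exact: smooth_partial.
- by move=> x; apply: continuousD; [exact: cf|exact: cg].
- by move=> i x; exact: derivableD.
- move=> i; rewrite (_ : partial i _ = partial i f + partial i g).
    exact: sop_add.
  by apply/funext => x; rewrite /partial deriveD.
Qed.

Lemma smooth_mul f g : smooth f -> smooth g -> smooth (f * g).
Proof. by move=> sf sg; apply: smooth_sum_of_products; exact: sop_mul. Qed.

Lemma smooth_lin f g c : smooth f -> smooth g -> smooth (c *: f + g).
Proof.
move=> sf sg; rewrite (_ : _ + _ = cst c * f + g * cst 1); last first.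
  by apply/funext => x; rewrite !fctE mulr1.
apply: smooth_sum_of_products.
by apply: sop_add; apply: sop_mul => //; exact: smooth_cst.
Qed.

Lemma test_function_mul (O : set E) f g :
  test_function O f -> smooth g -> test_function O (f * g).
Proof.
move=> [sf [K [cK KO K0]]] sg; split; first exact: smooth_mul.
by exists K; split=> // x /K0; rewrite fctE => ->; rewrite mul0r.
Qed.

Lemma test_function_lin (O : set E) f g c :
  test_function O f -> test_function O g -> test_function O (c *: f + g).
Proof.
move=> [sf [K [cK KO K0]]] [sg [K' [cK' KO' K0']]]; split.
  exact: smooth_lin.
exists (K `|` K'); split; first exact: compactU.
  by move=> x [/KO|/KO'].
by move=> x; rewrite -[~ _]/((~` (K `|` K')) x) setCU => -[/K0 fx /K0' gx];
  rewrite !fctE fx gx scaler0 addr0.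
Qed.

Lemma test_function0 (O : set E) : test_function O 0.
Proof.
split; first exact: smooth_cst.
by exists set0; split => //; exact: compact0.
Qed.

End smooth_functions.
(** * Square-integrable functions *)

Section square_integrable.
Context {R : realType} {d : nat} (Omega : set 'rV[R]_d).
Hypothesis mO : measurable Omega.
Local Notation mu := (lebesgue_rV R d).
Local Notation E := 'rV[R]_d.
Implicit Types (f g h : E -> R) (M c : R).

Lemma Rintegral_lin f g c :
  mu.-integrable Omega (EFin \o f) -> mu.-integrable Omega (EFin \o g) ->
  \int[mu]_(x in Omega) (c * f x + g x) =
  c * \int[mu]_(x in Omega) f x + \int[mu]_(x in Omega) g x.
Proof.
move=> If Ig; rewrite RintegralD// ?RintegralZl//.
by rewrite (_ : _ \o _ = fun x => (c%:E * (f x)%:E)%E)//; exact: integrableZl.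
Qed.

Lemma integrable_sumE (I : finType) (F : I -> E -> R) :
  (forall i, mu.-integrable Omega (EFin \o F i)) ->
  mu.-integrable Omega (EFin \o (fun x => \sum_i F i x)).
Proof.
move=> IF; rewrite (_ : _ \o _ = fun x => (\sum_i (EFin \o F i) x)%E).
  exact: integrable_sum.
by apply/funext => x /=; rewrite sumEFin.
Qed.

Lemma Rintegral_sum (I : finType) (F : I -> E -> R) :
  (forall i, mu.-integrable Omega (EFin \o F i)) ->
  \int[mu]_(x in Omega) (\sum_i F i x) = \sum_i \int[mu]_(x in Omega) F i x.
Proof.
move=> IF.
(* Integrability of the tail is carried through the induction because [RintegralD] asks for it. *)
have [] : mu.-integrable Omega (EFin \o (fun x => \sum_i F i x)) /\
  \int[mu]_(x in Omega) (\sum_i F i x) = \sum_i \int[mu]_(x in Omega) F i x.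
  elim: (index_enum I) => [|i s [IH1 IH2]].
    under eq_Rintegral do rewrite big_nil.
    rewrite big_nil /Rintegral integral0; split=> //.
    rewrite (_ : _ \o _ = cst 0%E); first exact: integrable0.
    by apply/funext => x /=; rewrite big_nil.
  under eq_Rintegral do rewrite big_cons.
  rewrite big_cons RintegralD// IH2; split=> //.
  rewrite (_ : _ \o _ = (EFin \o F i) \+ (EFin \o (fun x => \sum_(j <- s) F j x))).
    exact: integrableD.
  by apply/funext => x /=; rewrite big_cons EFinD.
by [].
Qed.

Lemma L2_sqr_integrable f : L2 Omega f ->
  mu.-integrable Omega (EFin \o (fun x => f x ^+ 2)).
Proof.
move=> [mf ff]; apply/integrableP; split.
  by apply/measurable_EFinP; exact: measurable_funX.
apply: le_lt_trans ff; rewrite le_eqVlt; apply/orP; left; apply/eqP.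
by apply: eq_integral => x _ /=; rewrite ger0_norm// sqr_ge0.
Qed.

Lemma L2_mul_integrable f g : L2 Omega f -> L2 Omega g ->
  mu.-integrable Omega (EFin \o (fun x => f x * g x)).
Proof.
move=> Lf Lg; have [mf _] := Lf; have [mg _] := Lg.
apply: (@le_integrable _ _ _ _ _ mO _
  (EFin \o (fun x => f x ^+ 2 + g x ^+ 2))).
- by apply/measurable_EFinP; exact: measurable_funM.
- move=> x _ /=; rewrite lee_fin [leRHS]ger0_norm ?addr_ge0 ?sqr_ge0//.
  rewrite ler_norml; apply/andP; split.
    by have := sqr_ge0 (f x + g x); rewrite sqrrD; nra.
  by have := sqr_ge0 (f x - g x); rewrite sqrrB; nra.
- rewrite (_ : _ \o _ = (EFin \o (fun x => f x ^+ 2)) \+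
                        (EFin \o (fun x => g x ^+ 2)))//.
  by apply: integrableD => //; exact: L2_sqr_integrable.
Qed.

Lemma L2_le f g : L2 Omega g -> measurable_fun Omega f ->
  (forall x, Omega x -> f x ^+ 2 <= g x ^+ 2) -> L2 Omega f.
Proof.
move=> [mg gg] mf fg; split => //; apply: le_lt_trans gg.
apply: ge0_le_integral => //=.
- by move=> x _; rewrite lee_fin sqr_ge0.
- by apply/measurable_EFinP; exact: measurable_funX.
- by apply/measurable_EFinP; exact: measurable_funX.
Qed.

Lemma L2_scale f c : L2 Omega f -> L2 Omega (c *: f).
Proof.
move=> Lf; have [mf _] := Lf; have I := L2_sqr_integrable Lf.
have mcf : measurable_fun Omega (c *: f).
  exact: (measurable_funM (measurable_cst c) mf).
split => //.
have /integrableP[_] := integrableZl mO (c ^+ 2) I.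
apply: le_lt_trans; rewrite le_eqVlt; apply/orP; left; apply/eqP.
apply: eq_integral => x _ /=. rewrite ger0_norm.
  by rewrite !fctE exprMn.
by rewrite mulr_ge0 ?sqr_ge0.
Qed.

Lemma L2_lin_closed : lin_closed (L2 Omega).
Proof.
split=> [|c f g Lf Lg].
  split; first exact: measurable_cst.
  by rewrite (eq_integral (cst 0%E)) ?integral0// => x _; rewrite expr0n.
have Lcf := L2_scale c Lf; have [mcf _] := Lcf; have [mg _] := Lg.
have mD : measurable_fun Omega (c *: f + g) by exact: measurable_funD.
split=> //.
have := integrableD mO (integrableD mO (L2_sqr_integrable Lcf)
  (L2_sqr_integrable Lg)) (integrableZl mO 2 (L2_mul_integrable Lcf Lg)).
move=> /integrableP[_].
apply: le_lt_trans; rewrite le_eqVlt; apply/orP; left; apply/eqP.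
apply: eq_integral => x _ /=. 
rewrite ger0_norm; first by rewrite !fctE; congr EFin; ring.
rewrite (_ : _ + _ = (c *: f x + g x) ^+ 2) ?sqr_ge0//.
by rewrite !fctE; ring.
Qed.

Lemma L2_bounded_mul f h M : L2 Omega f -> measurable_fun Omega h ->
  (forall x, Omega x -> `|h x| <= M) -> L2 Omega (h * f).
Proof.
move=> Lf mh hM; have [mf _] := Lf.
apply: L2_le (L2_scale M Lf) _ _; first exact: measurable_funM.
move=> x /hM hx; rewrite !fctE !exprMn ler_wpM2r ?sqr_ge0//.
by rewrite -[h x ^+ 2]real_normK ?num_real// ler_pXn2r ?nnegrE// (le_trans _ hx).
Qed.

Lemma L2_bounded f M : (mu Omega < +oo)%E -> measurable_fun Omega f ->
  (forall x, Omega x -> `|f x| <= M) -> L2 Omega f.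
Proof.
move=> Ofin mf fM; apply: L2_le (_ : L2 Omega (cst M)) mf _ => [|x Ox].
  split; first exact: measurable_cst.
  have := integral_cst mu mO ((M ^+ 2)%:E); rewrite /cst => ->.
  by rewrite lte_mul_pinfty// lee_fin sqr_ge0.
have := fM _ Ox => fx.
by rewrite -[f x ^+ 2]real_normK ?num_real// ler_pXn2r ?nnegrE// (le_trans _ fx).
Qed.

Lemma ip_semi : semi_ip (L2 Omega) (ip Omega).
Proof.
split.
- exact: L2_lin_closed.
- by move=> f g _ _; apply: eq_Rintegral => x _; rewrite mulrC.
- move=> c f g h Lf Lg Lh; rewrite /ip -Rintegral_lin;
    [|exact: L2_mul_integrable..].
  by apply: eq_Rintegral => x _; rewrite !fctE mulrDl -mulrA.
- by move=> f _; apply: Rintegral_ge0 => x _; rewrite -expr2 sqr_ge0.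
Qed.

Lemma ip_bounded_mul_le f g h M : L2 Omega f -> L2 Omega g ->
  measurable_fun Omega h -> 0 <= M -> (forall x, Omega x -> `|h x| <= M) ->
  `|ip Omega f (h * g)| <=
  M * (Num.sqrt (ip Omega f f) * Num.sqrt (ip Omega g g)).
Proof.
move=> Lf Lg mh M0 hM; have Lhg := L2_bounded_mul Lg mh hM.
apply: le_trans (semi_ip_CS ip_semi Lf Lhg) _.
rewrite mulrCA ler_wpM2l ?sqrtr_ge0//.
rewrite -[M in leRHS]ger0_norm// -sqrtr_sqr -sqrtrM ?sqr_ge0//.
have [_ _ _ ip0] := ip_semi.
rewrite ler_sqrt ?mulr_ge0 ?sqr_ge0 ?ip0//.
rewrite /ip -RintegralZl//; last exact: L2_mul_integrable.
apply: le_Rintegral => //.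
- exact: L2_mul_integrable.
- rewrite (_ : _ \o _ = fun x => ((M ^+ 2)%:E * (g x * g x)%:E)%E)//.
  by apply: integrableZl => //; exact: L2_mul_integrable.
- move=> x Ox; rewrite !fctE -expr2 exprMn -expr2 ler_wpM2r ?sqr_ge0//.
  rewrite -[h x ^+ 2]real_normK ?num_real// ler_pXn2r ?nnegrE//.
  exact: hM.
Qed.

End square_integrable.
(** * Traces and Sobolev spaces *)

Section hausdorff_null_sets.
Context {R : realType} {d : nat}.
Local Notation E := 'rV[R]_d.
Implicit Types (A B : set E) (s : nat).
Local Open Scope ereal_scope.

Lemma diam_ge0 A : 0 <= diam A.
Proof. by rewrite le_max lexx. Qed.

(** Nullity amounts to covers of arbitrarily small cost at every scale, a form in which covers can
    be handled directly. *)
Lemma hausdorff_nullP s A : hausdorff s A = 0 <->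
  forall delta eps : R, (0 < delta)%R -> (0 < eps)%R ->
  exists U : nat -> set E, [/\ A `<=` \bigcup_k U k,
    forall k, diam (U k) <= delta%:E &
    \sum_(0 <= k <oo) diam (U k) ^+ s < eps%:E].
Proof.
have sum0 (U : nat -> set E) : 0 <= \sum_(0 <= k <oo) diam (U k) ^+ s.
  by apply: nneseries_ge0 => k _ _; rewrite expe_ge0// diam_ge0.
split=> [A0 delta eps d0 e0|H].
  pose C := [set \sum_(0 <= k <oo) diam (U k) ^+ s |
    U in [set U : nat -> set E | A `<=` \bigcup_k U k /\
                                forall k, diam (U k) <= delta%:E]].
  have : ereal_inf C < eps%:E.
    apply: (@le_lt_trans _ _ 0); last by rewrite lte_fin.
    by rewrite -A0; apply: ereal_sup_ubound; exists delta.
  by move=> /ereal_inf_lt[_ [U [AU Ud] <-] Ue]; exists U.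
apply/eqP; rewrite eq_le; apply/andP; split.
  apply: ge_ereal_sup => _ [delta d0 <-].
  apply/lee_addgt0Pr => e e0; rewrite add0e.
  have [U [AU Ud Ue]] := H _ _ d0 e0.
  by apply: le_trans (ltW Ue); apply: ereal_inf_lbound; exists U.
apply: le_trans (_ : _ <= ereal_inf _) _; last first.
  by apply: ereal_sup_ubound; exists 1%R => //=; exact: ltr01.
by apply: le_ereal_inf_tmp => _ [U _ <-].
Qed.

Lemma hausdorff_null_sub s A B : A `<=` B -> hausdorff s B = 0 ->
  hausdorff s A = 0.
Proof.
move=> AB /hausdorff_nullP HB; apply/hausdorff_nullP => delta eps d0 e0.
by have [U [BU Ud Ue]] := HB _ _ d0 e0; exists U; split=> // x /AB /BU.
Qed.

Lemma hausdorff_null_setU s A B : hausdorff s A = 0 -> hausdorff s B = 0 ->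
  hausdorff s (A `|` B) = 0.
Proof.
move=> /hausdorff_nullP HA /hausdorff_nullP HB.
apply/hausdorff_nullP => delta eps d0 e0.
have e20 : (0 < eps / 2)%R by rewrite divr_gt0.
have [U [AU Ud Ue]] := HA _ _ d0 e20.
have [V [BV Vd Ve]] := HB _ _ d0 e20.
(* The two covers are interleaved. Partial sums for W are then compared up to an even index, where
   they split into pairs. *)
pose W k := if odd k then U k./2 else V k./2.
have WE k : W k.*2.+1 = U k /\ W k.*2 = V k.
  by rewrite /W /= odd_double/= uphalf_double doubleK.
exists W; split.
- by move=> x [/AU[k _ Ux]|/BV[k _ Vx]];
    [exists k.*2.+1|exists k.*2] => //; rewrite ?(WE k).1 ?(WE k).2.
- by move=> k; rewrite /W; case: ifP.
have ge0 (X : nat -> set E) k : 0 <= diam (X k) ^+ s.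
  by rewrite expe_ge0// diam_ge0.
apply: (@le_lt_trans _ _ (\sum_(0 <= k <oo) diam (U k) ^+ s +
                          \sum_(0 <= k <oo) diam (V k) ^+ s)); last first.
  by rewrite (_ : eps%:E = (eps / 2)%:E + (eps / 2)%:E) ?lteD// -EFinD -splitr.
rewrite -nneseriesD//; apply: lime_le; first exact: is_cvg_nneseries.
near=> n; apply: (@le_trans _ _ (\sum_(0 <= k < n.*2) diam (W k) ^+ s)).
  apply: lee_sum_nneg_natr => //.
  by rewrite -addnn leq_addr.
apply: (@le_trans _ _ (\sum_(0 <= k < n) (diam (U k) ^+ s + diam (V k) ^+ s))).
  elim: (n) => [|m IH]; first by rewrite !big_geq.
  rewrite doubleS !big_nat_recr//= -addeA leeD//.
  by have [-> ->] := WE m; rewrite addeC.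
by apply: nneseries_lim_ge => k _ _; rewrite adde_ge0.
Unshelve. all: by end_near.
Qed.

(** For [s = 0] every term [diam (U k) ^+ 0] is 1, so even the empty set would have infinite
    measure. *)
Lemma hausdorff_set0 s : (0 < s)%N -> hausdorff s (set0 : set E) = 0.
Proof.
case: s => // s _; apply/hausdorff_nullP => delta eps d0 e0.
have D0 : diam (set0 : set E) = 0.
  rewrite /diam (_ : [set _ | _ in _ & _ in _] = set0) ?ereal_sup0 ?maxeNy//.
  by apply/seteqP; split=> // x [].
exists (fun=> set0); split=> [//|k|]; first by rewrite D0 lee_fin ltW.
by rewrite eseries0 ?lte_fin// => k _ _; rewrite D0 expeS mul0e.
Qed.

End hausdorff_null_sets.

(** Serves for [H10], where P is the class of jets of test functions. *)
Lemma semi_ip_closure (R : realType) (Z : lmodType R) (S P : Z -> Prop)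
    (a : Z -> Z -> R) :
  semi_ip S a -> lin_closed P -> (forall z, P z -> S z) ->
  lin_closed (fun w => S w /\ forall eps, 0 < eps ->
    exists z, P z /\ Num.sqrt (a (w - z) (w - z)) < eps).
Proof.
move=> aS Plin PS; have [Slin _ _ _] := aS.
split.
  split=> [|eps e0]; first exact: Slin.1.
  exists 0; split; first exact: Plin.1.
  by rewrite subrr (semi_ip0l aS Slin.1) sqrtr0.
move=> c w w' [Sw Hw] [Sw' Hw']; split=> [|eps e0]; first exact: Slin.2.
have c0 : 0 < `|c| + 1 by rewrite ltr_pwDr.
have e20 : 0 < eps / 2 by rewrite divr_gt0.
(* The denominator [|c| + 1] also covers c = 0. *)
have [z [Pz wz]] := Hw _ (divr_gt0 e20 c0).
have [z' [Pz' wz']] := Hw' _ e20.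
exists (c *: z + z'); split; first exact: Plin.2.
have Sz := PS _ Pz; have Sz' := PS _ Pz'.
rewrite (_ : _ - _ = c *: (w - z) + (w' - z')); last first.
  by rewrite scalerBr opprD addrACA.
have Swz : S (w - z) by exact: lin_closedB.
have Swz' : S (w' - z') by exact: lin_closedB.
apply: le_lt_trans (semi_ip_triangle aS (lin_closedZ c Slin Swz) Swz') _.
rewrite (semi_ip_normZ aS)// [ltRHS]splitr; apply: ler_ltD => //.
apply: le_trans (_ : `|c| * (eps / 2 / (`|c| + 1)) <= _).
  by rewrite ler_wpM2l// ltW.
by rewrite mulrCA ler_piMr ?(ltW e20)// ler_pdivrMr// mul1r lerDl.
Qed.

Section jets.
Context {R : realType} {d : nat}.
Implicit Types (w z : jet R d) (v : vjet R d).

Lemma jet_lin1 c w z : (c *: w + z).1 = c *: w.1 + z.1.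
Proof. by []. Qed.

Lemma jet_lin2 c w z i : (c *: w + z).2 i = c *: w.2 i + z.2 i.
Proof. by []. Qed.

Lemma jet_lin1x c w z x : (c *: w + z).1 x = c * w.1 x + z.1 x.
Proof. by rewrite jet_lin1. Qed.

Lemma jet_lin2x c w z i x : (c *: w + z).2 i x = c * w.2 i x + z.2 i x.
Proof. by rewrite jet_lin2. Qed.

Lemma vjet_lin c v v' i : (c *: v + v') i = c *: v i + v' i.
Proof. by []. Qed.

Lemma jetB1 w z : (w - z).1 = w.1 - z.1.
Proof. by []. Qed.

Lemma jetB2 w z i : (w - z).2 i = w.2 i - z.2 i.
Proof. by []. Qed.

End jets.

Section sobolev_theory.
Context {R : realType} {d : nat} (Omega : set 'rV[R]_d).
Hypotheses (oO : open Omega) (bO : bounded_set Omega).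
Local Notation mu := (lebesgue_rV R d).
Local Notation E := 'rV[R]_d.
Implicit Types (w z : jet R d) (u v : vjet R d) (phi psi : E -> R).

Let mO : measurable Omega. Proof. exact: open_measurable_rV. Qed.

(** Boundedness of [Omega] gives both a uniform bound on phi and a finite measure. *)
Lemma L2_continuous phi : continuous phi -> L2 Omega phi.
Proof.
move=> cphi; have [M _ phiM] := continuous_bounded_on bO cphi.
apply: L2_bounded phiM => //; first exact: lebesgue_rV_bounded.
exact: continuous_measurable_rV.
Qed.

Lemma L2_smooth phi : smooth phi -> L2 Omega phi.
Proof. by move=> /smooth_continuous; exact: L2_continuous. Qed.

Lemma H1_lin_closed : lin_closed (H1 Omega).
Proof.
have [L0 LD] := L2_lin_closed mO.
have ips := ip_semi mO.
split=> [|c w z [Lw Lgw Dw] [Lz Lgz Dz]].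
  split=> // phi [sphi _] i.
  have Lp := L2_smooth sphi; have Lpp := L2_smooth (smooth_partial i sphi).
  by rewrite !(semi_ip0l ips)// oppr0.
split=> [|i|phi tphi i].
- by rewrite jet_lin1; exact: LD.
- by rewrite jet_lin2; exact: LD.
rewrite jet_lin1 jet_lin2.
have [sphi _] := tphi.
have Lp := L2_smooth sphi; have Lpp := L2_smooth (smooth_partial i sphi).
have [_ _ ipD _] := ips.
by rewrite !ipD// Dw// Dz//; ring.
Qed.

Lemma grad_ip_semi : semi_ip (H1 Omega) (grad_ip Omega).
Proof.
apply: (semi_ip_sum (L := fun i (w : jet R d) => w.2 i)) (ip_semi mO) _ _ _.
- exact: H1_lin_closed.
- by [].
- by move=> i w [].
Qed.

(** By conversion [H1norm Omega w] is the square root of [H1ip w w], so the semi-inner product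
    lemmas apply to it. *)
Definition H1ip w z := ip Omega w.1 z.1 + grad_ip Omega w z.

Lemma H1ip_semi : semi_ip (H1 Omega) H1ip.
Proof.
apply: semi_ip_add grad_ip_semi.
have [_ sym ipD ip0] := ip_semi mO.
split.
- exact: H1_lin_closed.
- by move=> w z [? _ _] [? _ _]; exact: sym.
- by move=> c w w' z [? _ _] [? _ _] [? _ _]; exact: ipD.
- by move=> w [? _ _]; exact: ip0.
Qed.

Lemma ip_le_H1norm w : H1 Omega w ->
  Num.sqrt (ip Omega w.1 w.1) <= H1norm Omega w /\
  (forall i, Num.sqrt (ip Omega (w.2 i) (w.2 i)) <= H1norm Omega w).
Proof.
move=> H1w; have [Lw Lgw _] := H1w.
have [_ _ _ ip0] := ip_semi mO; have [_ _ _ g0] := grad_ip_semi.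
have [_ _ _ h0] := H1ip_semi.
split=> [|i]; rewrite ler_sqrt ?(h0 w)//; first by rewrite lerDl g0.
rewrite /grad_ip (bigD1 i)//= addrCA lerDl addr_ge0 ?ip0// sumr_ge0// => j _.
exact: ip0.
Qed.

Lemma vgrad_ip_semi : semi_ip (fun v => forall i, H1 Omega (v i))
  (vgrad_ip Omega).
Proof.
have [H10 H1D] := H1_lin_closed.
apply: (semi_ip_sum (L := fun i (v : vjet R d) => v i)) grad_ip_semi _ _ _.
- by split=> [i|c v v' Hv Hv' i]; [exact: H10|exact: H1D].
- by [].
- by move=> i v.
Qed.

Lemma jet_of_lin phi psi c : smooth phi -> smooth psi ->
  jet_of (c *: phi + psi) = c *: jet_of phi + jet_of psi.
Proof.
move=> sp sq; rewrite /jet_of; congr (_, _).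
by apply/funext => i; rewrite partial_lin.
Qed.

Lemma jet_of0 : jet_of (0 : E -> R) = 0.
Proof.
rewrite /jet_of; congr (_, _); apply/funext => i; apply/funext => x.
by rewrite /partial derive_cst.
Qed.

Lemma H1_jet0 : H1 Omega (jet_of 0).
Proof. by rewrite jet_of0; have [] := H1_lin_closed. Qed.

Lemma H10_lin_closed : lin_closed (H10 Omega).
Proof.
pose P w := exists phi, [/\ test_function Omega phi, H1 Omega (jet_of phi) &
  w = jet_of phi].
have Plin : lin_closed P.
  split.
    by exists 0; split; [exact: test_function0|exact: H1_jet0|rewrite jet_of0].
  move=> c _ _ [phi [tp Hp ->]] [psi [tq Hq ->]].
  have e := jet_of_lin c tp.1 tq.1.
  exists (c *: phi + psi); split; first exact: test_function_lin.
    by rewrite e; apply: H1_lin_closed.2.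
  exact/esym.
have := semi_ip_closure H1ip_semi Plin.
have PH w : P w -> H1 Omega w by move=> [phi [_ Hp ->]].
move=> /(_ PH) HP.
have PE w : H10 Omega w <-> H1 Omega w /\ (forall eps : R, 0 < eps ->
    exists z, P z /\ Num.sqrt (H1ip (w - z) (w - z)) < eps).
  split=> -[Hw Happ]; split=> // eps /Happ.
    by move=> [phi [tp Hp wp]]; exists (jet_of phi); split => //; exists phi.
  by move=> [_ [[phi [tp Hp ->]] wp]]; exists phi.
split; first by apply/PE; exact: HP.1.
by move=> c z z' /PE Hz /PE Hz'; apply/PE; exact (HP.2 c z z' Hz Hz').
Qed.

Lemma has_trace_lin w w' (gam gam' : E -> R) c : H1 Omega w -> H1 Omega w' ->
  has_trace Omega w gam -> has_trace Omega w' gam' ->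
  has_trace Omega (c *: w + w') (c *: gam + gam').
Proof.
move=> Hw Hw' [phi [sp wp gp]] [psi [sq wq gq]].
have Hlin := H1_lin_closed.
have E1 n : jet_of (c *: phi n + psi n) = c *: jet_of (phi n) + jet_of (psi n).
  by apply: jet_of_lin; [have [] := sp n|have [] := sq n].
exists (fun n => c *: phi n + psi n); split.
- move=> n; have [sp1 sp2] := sp n; have [sq1 sq2] := sq n.
  split; first exact: smooth_lin.
  by rewrite E1; exact: Hlin.2.
- apply: (@squeeze_cvgr _ _ _ _ (fun=> 0) (fun n =>
    `|c| * H1norm Omega (w - jet_of (phi n)) +
    H1norm Omega (w' - jet_of (psi n)))).
  + near=> n; rewrite sqrtr_ge0/=.
    have [sp1 sp2] := sp n; have [sq1 sq2] := sq n.
    rewrite E1 (_ : _ - _ = c *: (w - jet_of (phi n)) + (w' - jet_of (psi n)));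
      last by rewrite scalerBr opprD addrACA.
    have S1 : H1 Omega (w - jet_of (phi n)) by exact: lin_closedB.
    have S2 : H1 Omega (w' - jet_of (psi n)) by exact: lin_closedB.
    rewrite -(semi_ip_normZ H1ip_semi c S1).
    exact (semi_ip_triangle H1ip_semi (lin_closedZ c Hlin S1) S2).
  + exact: cvg_cst.
  + have lim0 (p q : nat -> R) : p n @[n --> \oo] --> 0 ->
        q n @[n --> \oo] --> 0 -> `|c| * p n + q n @[n --> \oo] --> 0.
      move=> p0 q0; rewrite -[X in _ --> X]addr0.
      rewrite -[X in _ --> X + _](mulr0 `|c|).
      by apply: cvgD => //; apply: cvgMr.
    exact (lim0 _ _ wp wq).
(* Where both sequences converge so does the combination, so the exceptional set lies in the union
   of two null sets. *)
- apply: hausdorff_null_sub (hausdorff_null_setU gp gq).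
  move=> x [bx nx].
  have [px|npx] := pselect ((phi n x @[n --> \oo]) --> gam x); last first.
    by left.
  right; split=> // qx; apply: nx => /=.
  by apply: cvgD => //; apply: cvgZr.
Unshelve. all: by end_near.
Qed.

Lemma vanishes_on_lin (Gamma : set E) w w' c : H1 Omega w -> H1 Omega w' ->
  vanishes_on Omega Gamma w -> vanishes_on Omega Gamma w' ->
  vanishes_on Omega Gamma (c *: w + w').
Proof.
move=> Hw Hw' [gam [tg g0]] [gam' [tg' g0']].
exists (c *: gam + gam'); split; first exact: has_trace_lin.
apply: hausdorff_null_sub (hausdorff_null_setU g0 g0') => x [Gx nx].
have [gx|] := pselect (gam x = 0); last by left.
right; split=> // gx'; apply: nx.
by rewrite !fctE gx gx' scaler0 addr0.
Qed.

(** For the zero jet the exceptional boundary sets are empty; [1 < d] makes the surface dimension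
    positive, so that they are null. *)
Lemma spaceD_lin_closed (Gamma : set E) : (1 < d)%N ->
  lin_closed (spaceD Omega Gamma).
Proof.
move=> d1; have s0 : (0 < d.-1)%N by case: (d) d1 => // -[].
have [H0 HD] := H1_lin_closed.
split=> [|c w w' [Hw vw] [Hw' vw']]; last first.
  by split; [exact: HD|exact: vanishes_on_lin].
split=> //; exists 0; split.
  exists (fun=> 0); split.
  - by move=> _; split; [exact: smooth_cst|exact: H1_jet0].
  - rewrite jet_of0 subrr /H1norm -/(H1ip 0 0) (semi_ip0l H1ip_semi)// sqrtr0.
    exact: cvg_cst.
  - rewrite (_ : _ `&` _ = set0); first exact: hausdorff_set0.
    apply/seteqP; split=> // x [_]; apply.
    exact: cvg_cst.
rewrite (_ : _ `&` _ = set0); first exact: hausdorff_set0.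
by apply/seteqP; split=> // x [_]; apply.
Qed.

Lemma divergence_L2 v : (forall i, H1 Omega (v i)) -> L2 Omega (divergence v).
Proof.
move=> Hv; have [L0 LD] := L2_lin_closed mO.
have -> : divergence v = \sum_i (v i).2 i.
  by apply/funext => x; rewrite fct_sumE.
apply: (big_ind (L2 Omega)) => //.
  by move=> f g Lf Lg; rewrite -[f]scale1r; exact: LD.
by move=> i _; case: (Hv i).
Qed.

Lemma spaceX_H1 v : spaceX Omega v -> forall i, H1 Omega (v i).
Proof. by move=> Xv i; case: (Xv i). Qed.

Lemma spaceX_lin_closed : lin_closed (spaceX Omega).
Proof.
have [H0 HD] := H10_lin_closed.
split=> [i|c v v' Xv Xv' i]; first exact H0.
exact (HD c _ _ (Xv i) (Xv' i)).
Qed.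

Lemma spaceV_lin_closed : lin_closed (spaceV Omega).
Proof.
have [X0 XD] := spaceX_lin_closed.
have ips := ip_semi mO; have [_ _ ipD _] := ips.
split=> [|c v v' [Xv dv] [Xv' dv']].
  split=> // q [Lq _].
  rewrite (_ : divergence 0 = 0) ?(semi_ip0l ips)//.
  by apply/funext => x; rewrite /divergence big1.
split=> [|q Qq]; first exact: XD.
have [Lq _] := Qq.
rewrite (_ : divergence _ = c *: divergence v + divergence v').
  have Hv := divergence_L2 (spaceX_H1 Xv).
  have Hv' := divergence_L2 (spaceX_H1 Xv').
  by rewrite ipD// dv// dv'// mulr0 addr0.
apply/funext => x; rewrite !fctE /divergence scaler_sumr -big_split/=.
by apply: eq_bigr => i _.
Qed.

(** The common part of [H10] and [spaceD], free of boundary conditions, so that one Leibniz argument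
    serves velocity components and temperatures. *)
Definition smoothly_approximable w := forall eps, 0 < eps -> exists psi,
  [/\ smooth psi, H1 Omega (jet_of psi) & H1norm Omega (w - jet_of psi) < eps].

Lemma H10_approximable w : H10 Omega w -> smoothly_approximable w.
Proof. by move=> [_ H] eps /H[phi [[sp _] Hp wp]]; exists phi. Qed.

Lemma spaceD_approximable Gamma w : spaceD Omega Gamma w ->
  smoothly_approximable w.
Proof.
move=> [_ [gam [[phi [sp wp _]] _]]] eps e0.
have /cvgrPdist_lt/(_ eps e0)[N _ HN] := wp.
exists (phi N); have [? ?] := sp N; split=> //.
have := HN N (leqnn N); rewrite /= sub0r normrN.
exact: le_lt_trans (ler_norm _).
Qed.

(* [phi * psi] is a test function when [psi] is smooth, so the weak formula of
   [w] gives the identity with [psi] in place of one factor [w]; both sides are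
   continuous in [psi] for the H^1 norm. *)
Lemma weak_leibniz w phi i : H1 Omega w -> smoothly_approximable w ->
  test_function Omega phi ->
  ip Omega w.1 (partial i phi * w.1) + ip Omega w.1 (phi * w.2 i) +
  ip Omega (w.2 i) (phi * w.1) = 0.
Proof.
move=> Hw wapp tphi; have [sphi _] := tphi.
have cphi := smooth_continuous sphi.
have cdphi := smooth_continuous (smooth_partial i sphi).
have [M1 M10 phiM] := continuous_bounded_on bO cphi.
have [M2 M20 dphiM] := continuous_bounded_on bO cdphi.
have mphi : measurable_fun Omega phi by exact: continuous_measurable_rV.
have mdphi : measurable_fun Omega (partial i phi).
  exact: continuous_measurable_rV.
have ips := ip_semi mO; have [_ sym ipD _] := ips.
pose B z := ip Omega w.1 (partial i phi * z.1) + ip Omega w.1 (phi * z.2 i) +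
  ip Omega (w.2 i) (phi * z.1).
have [Lw Lgw Dw] := Hw.
have L1 f : L2 Omega f -> L2 Omega (phi * f).
  by move=> Lf; exact: L2_bounded_mul phiM.
have L2' f : L2 Omega f -> L2 Omega (partial i phi * f).
  by move=> Lf; exact: L2_bounded_mul dphiM.
have ipB f g h : L2 Omega f -> L2 Omega g -> L2 Omega h ->
    ip Omega h (f - g) = ip Omega h f - ip Omega h g.
  move=> Lf Lg Lh; rewrite sym//; last exact: lin_closedB (L2_lin_closed mO) _ _.
  by rewrite (semi_ipBl ips)// (sym f)// (sym g).
have BB z z' : H1 Omega z -> H1 Omega z' -> B (z - z') = B z - B z'.
  move=> [Lz Lgz _] [Lz' Lgz' _]; rewrite /B.
  rewrite jetB1 jetB2.
  by rewrite !mulrBr !ipB; auto; ring.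
have B0 psi : smooth psi -> H1 Omega (jet_of psi) -> B (jet_of psi) = 0.
  move=> sp [Lp Lgp _]; rewrite /B /=.
  have := Dw _ (test_function_mul tphi sp) i.
  rewrite partial_mul// => H.
  rewrite [X in X + _]addrC -[X in X + _]opprK.
  have <- : ip Omega w.1 (phi * partial i psi + partial i phi * psi) =
    ip Omega w.1 (phi * partial i psi) + ip Omega w.1 (partial i phi * psi).
    have LA : L2 Omega (phi * partial i psi) by apply: L1; exact: Lgp.
    have LB : L2 Omega (partial i phi * psi) by apply: L2'.
    have LAB := lin_closedD (L2_lin_closed mO) LA LB.
    by rewrite sym// (semi_ipDl ips)// (sym _ w.1)// (sym _ w.1).
  by rewrite H opprK; ring.
(* [M1] bounds phi, which occurs in two terms of [B]; [M2] bounds its derivative, which occurs in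
   one. *)
pose C := (M1 + M1 + M2) * H1norm Omega w.
have nw0 : 0 <= H1norm Omega w by exact: sqrtr_ge0.
have C0 : 0 <= C by rewrite mulr_ge0// !addr_ge0.
have Ble z : H1 Omega z -> `|B z| <= C * H1norm Omega z.
  move=> Hz; have [Lz Lgz _] := Hz.
  have [z1 z2] := ip_le_H1norm Hz; have [w1 w2] := ip_le_H1norm Hw.
  have b1 := ip_bounded_mul_le mO Lw Lz mdphi M20 dphiM.
  have b2 := ip_bounded_mul_le mO Lw (Lgz i) mphi M10 phiM.
  have b3 := ip_bounded_mul_le mO (Lgw i) Lz mphi M10 phiM.
  have t1 : M2 * (Num.sqrt (ip Omega w.1 w.1) * Num.sqrt (ip Omega z.1 z.1)) <=
    M2 * (H1norm Omega w * H1norm Omega z).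
    by rewrite ler_wpM2l// ler_pM// sqrtr_ge0.
  have t2 : M1 * (Num.sqrt (ip Omega w.1 w.1) *
      Num.sqrt (ip Omega (z.2 i) (z.2 i))) <=
    M1 * (H1norm Omega w * H1norm Omega z).
    by rewrite ler_wpM2l// ler_pM// sqrtr_ge0.
  have t3 : M1 * (Num.sqrt (ip Omega (w.2 i) (w.2 i)) *
      Num.sqrt (ip Omega z.1 z.1)) <=
    M1 * (H1norm Omega w * H1norm Omega z).
    by rewrite ler_wpM2l// ler_pM// sqrtr_ge0.
  have n1 := ler_normD (ip Omega w.1 (partial i phi * z.1) +
    ip Omega w.1 (phi * z.2 i)) (ip Omega (w.2 i) (phi * z.1)).
  have n2 := ler_normD (ip Omega w.1 (partial i phi * z.1))
    (ip Omega w.1 (phi * z.2 i)).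
  by rewrite /C /B !mulrDl -!mulrA; lra.
apply/eqP; rewrite -normr_le0; apply/ler_addgt0Pr => e e0; rewrite add0r.
have [psi [sp Hp wp]] := wapp (e / (C + 1)) (divr_gt0 e0 (ltr_pwDr ltr01 C0)).
rewrite -/(B w) -[B w]subr0 -(B0 _ sp Hp) -BB//.
apply: le_trans (Ble _ (lin_closedB H1_lin_closed Hw Hp)) _.
apply: le_trans (_ : (C + 1) * (e / (C + 1)) <= _).
  by apply: ler_pM => //; [exact: sqrtr_ge0|rewrite lerDl|exact: ltW].
by rewrite mulrC divfK// gt_eqF// ltr_pwDr.
Qed.

End sobolev_theory.
(** * The trilinear forms *)

Section trilinear_forms.
Context {R : realType} {d : nat} (Omega : set 'rV[R]_d).
Hypothesis mO : measurable Omega.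
Local Notation mu := (lebesgue_rV R d).
Local Notation E := 'rV[R]_d.

(** Linearity of the integrand passes to the integral only where the integrands are integrable,
    which is how the regularity of [Omega] enters. *)
Lemma Rintegral_trilinear (A B C : lmodType R) (SA : A -> Prop)
    (SB : B -> Prop) (SC : C -> Prop) (F : A -> B -> C -> E -> R) :
  (forall x, trilinear SA SB SC (fun a b c => F a b c x)) ->
  (forall a b c, SA a -> SB b -> SC c ->
     mu.-integrable Omega (EFin \o F a b c)) ->
  trilinear SA SB SC (fun a b c => \int[mu]_(x in Omega) F a b c x).
Proof.
move=> tF iF; split=> k a b c e *; rewrite -Rintegral_lin//; try exact: iF;
  by apply: eq_Rintegral => x _; case: (tF x) => t1 t2 t3;
    rewrite (t1, t2, t3).
Qed.

Lemma trilinear_addZ (A B C : lmodType R) (SA : A -> Prop) (SB : B -> Prop)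
    (SC : C -> Prop) (t t' : A -> B -> C -> R) k :
  trilinear SA SB SC t -> trilinear SA SB SC t' ->
  trilinear SA SB SC (fun a b c => t a b c + k * t' a b c).
Proof.
move=> [t1 t2 t3] [t1' t2' t3']; split=> *.
- by rewrite t1// t1'//; ring.
- by rewrite t2// t2'//; ring.
- by rewrite t3// t3'//; ring.
Qed.

(** By conversion [convection] and [div_term] are sums of [hconvection] and [hdiv_term] over the
    components of the last two arguments. *)
Lemma trilinear_sum (A B C : lmodType R) (SA : ('I_d -> A) -> Prop)
    (SB : ('I_d -> B) -> Prop) (SC : ('I_d -> C) -> Prop)
    (t : ('I_d -> A) -> B -> C -> R) :
  trilinear SA (fun=> True) (fun=> True) t ->
  trilinear SA SB SC (fun a b c => \sum_j t a (b j) (c j)).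
Proof.
move=> [t1 t2 t3]; split=> *; rewrite mulr_sumr -big_split/=;
  apply: eq_bigr => j _.
- exact: t1.
- exact: t2.
- exact: t3.
Qed.

Lemma hconvection_trilinear SA SB SC x :
  trilinear SA SB SC (fun (u : vjet R d) s t => hconvection u s t x).
Proof.
split=> c u s t p _ _ _ _; rewrite /hconvection.
- have e i : ((c *: u + s) i).1 x = c * (u i).1 x + (s i).1 x.
    by rewrite vjet_lin jet_lin1x.
  under eq_bigr do rewrite e mulrDl -mulrA.
  by rewrite big_split/= -mulr_sumr; ring.
- under eq_bigr do rewrite jet_lin2x mulrDr mulrCA.
  by rewrite big_split/= -mulr_sumr; ring.
- by rewrite jet_lin1x; ring.
Qed.

Lemma hdiv_term_trilinear SA SB SC x :
  trilinear SA SB SC (fun (u : vjet R d) s t => hdiv_term u s t x).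
Proof.
split=> c u s t p _ _ _ _; rewrite /hdiv_term /divergence.
- have e i : ((c *: u + s) i).2 i x = c * (u i).2 i x + (s i).2 i x.
    by rewrite vjet_lin jet_lin2x.
  under eq_bigr do rewrite e.
  by rewrite big_split/= -mulr_sumr; ring.
- by rewrite jet_lin1x; ring.
- by rewrite jet_lin1x; ring.
Qed.

Lemma bh_trilinear SA SB SC :
  (forall u s t, SA u -> SB s -> SC t ->
     mu.-integrable Omega (EFin \o hconvection u s t) /\
     mu.-integrable Omega (EFin \o hdiv_term u s t)) ->
  trilinear SA SB SC (@bh R d Omega).
Proof.
move=> iF; apply: trilinear_addZ; apply: Rintegral_trilinear.
- by move=> x; exact: hconvection_trilinear.
- by move=> u s t Su Ss St; case: (iF u s t).
- by move=> x; exact: hdiv_term_trilinear.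
- by move=> u s t Su Ss St; case: (iF u s t).
Qed.

Lemma b_trilinear SA SB SC :
  (forall u v w, SA u -> SB v -> SC w ->
     mu.-integrable Omega (EFin \o convection u v w) /\
     mu.-integrable Omega (EFin \o div_term u v w)) ->
  trilinear SA SB SC (@b R d Omega).
Proof.
move=> iF; apply: trilinear_addZ; apply: Rintegral_trilinear.
- by move=> x; exact: trilinear_sum (hconvection_trilinear _ _ _ x).
- by move=> u s t Su Ss St; case: (iF u s t).
- by move=> x; exact: trilinear_sum (hdiv_term_trilinear _ _ _ x).
- by move=> u s t Su Ss St; case: (iF u s t).
Qed.

End trilinear_forms.

(** * Skew-symmetry of the trilinear forms by density of test fields *)

Section skew_symmetry.
Context {R : realType} {d : nat} (Omega : set 'rV[R]_d).
Hypotheses (oO : open Omega) (bO : bounded_set Omega).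
Local Notation mu := (lebesgue_rV R d).
Local Notation E := 'rV[R]_d.

Let mO : measurable Omega. Proof. exact: open_measurable_rV. Qed.

Definition vjet_of (phi : 'I_d -> E -> R) : vjet R d := fun i => jet_of (phi i).

Lemma L2_smooth_mul (phi f : E -> R) : smooth phi -> L2 Omega f ->
  L2 Omega (phi * f).
Proof.
move=> /smooth_continuous cphi Lf.
have [M _ phiM] := continuous_bounded_on bO cphi.
apply: L2_bounded_mul phiM => //.
exact: continuous_measurable_rV.
Qed.

Section test_field.
Context (phi : 'I_d -> E -> R) (tphi : forall i, test_function Omega (phi i)).

Lemma hconvection_vjet_of (s : jet R d) : H1 Omega s ->
  mu.-integrable Omega (EFin \o hconvection (vjet_of phi) s s) /\
  \int[mu]_(x in Omega) hconvection (vjet_of phi) s s x =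
    \sum_i ip Omega (s.2 i) (phi i * s.1).
Proof.
move=> [Ls Lgs _].
have iF i : mu.-integrable Omega (EFin \o (fun x => s.2 i x * (phi i * s.1) x)).
  apply: L2_mul_integrable => //.
  by apply: L2_smooth_mul => //; case: (tphi i).
have -> : hconvection (vjet_of phi) s s =
    (fun x => \sum_i s.2 i x * (phi i * s.1) x).
  apply/funext => x; rewrite /hconvection mulr_suml.
  by apply: eq_bigr => i _; rewrite fctE mulrCA mulrA.
by split; [exact: integrable_sumE|rewrite Rintegral_sum].
Qed.

Lemma hdiv_term_vjet_of (s : jet R d) : H1 Omega s ->
  mu.-integrable Omega (EFin \o hdiv_term (vjet_of phi) s s) /\
  \int[mu]_(x in Omega) hdiv_term (vjet_of phi) s s x =
    \sum_i ip Omega s.1 (partial i (phi i) * s.1).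
Proof.
move=> [Ls Lgs _].
have iF i : mu.-integrable Omega
    (EFin \o (fun x => s.1 x * (partial i (phi i) * s.1) x)).
  apply: L2_mul_integrable => //.
  by apply: L2_smooth_mul => //; apply: smooth_partial; case: (tphi i).
have -> : hdiv_term (vjet_of phi) s s =
    (fun x => \sum_i s.1 x * (partial i (phi i) * s.1) x).
  apply/funext => x; rewrite /hdiv_term /divergence !mulr_suml.
  by apply: eq_bigr => i _; rewrite fctE mulrCA mulrA.
by split; [exact: integrable_sumE|rewrite Rintegral_sum].
Qed.

(** Two of the three terms of [weak_leibniz] coincide, so half of that identity says that the i-th
    summand of [bh] is zero. *)
Lemma bh_vjet_of_skew (s : jet R d) : H1 Omega s ->
  smoothly_approximable Omega s -> bh Omega (vjet_of phi) s s = 0.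
Proof.
move=> Hs sapp; rewrite /bh (hconvection_vjet_of Hs).2 (hdiv_term_vjet_of Hs).2.
rewrite mulr_sumr -big_split/=; apply: big1 => i _.
have := weak_leibniz oO bO i Hs sapp (tphi i).
rewrite (_ : ip Omega s.1 (phi i * s.2 i) = ip Omega (s.2 i) (phi i * s.1)).
  by lra.
by apply: eq_Rintegral => x _; rewrite !fctE; ring.
Qed.

(** Reduces to [bh] on each component: for a test field each summand is separately integrable, so
    sum and integral can be exchanged. *)
Lemma b_vjet_of_skew (v : vjet R d) : spaceX Omega v ->
  b Omega (vjet_of phi) v v = 0.
Proof.
move=> Xv; have Hv := spaceX_H1 Xv.
rewrite (_ : b _ _ _ _ = \sum_j bh Omega (vjet_of phi) (v j) (v j)).
  rewrite big1// => j _; apply: bh_vjet_of_skew => //.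
  exact/H10_approximable/Xv.
rewrite /b /bh big_split/= -mulr_sumr.
rewrite -!Rintegral_sum// => j; first exact: (hdiv_term_vjet_of (Hv j)).1.
exact: (hconvection_vjet_of (Hv j)).1.
Qed.

End test_field.

(** Components are approximated independently, so the test field need not be divergence free.
    Skewness is accordingly obtained on all of X, thanks to the half divergence term in the
    forms. *)
Lemma spaceX_dense (u : vjet R d) : spaceX Omega u ->
  forall eps, 0 < eps -> exists phi : 'I_d -> E -> R,
    [/\ forall i, test_function Omega (phi i), spaceX Omega (vjet_of phi) &
        vnorm1 Omega (u - vjet_of phi) <= eps].
Proof.
(* The d squared component errors sum to at most d (eps / (d + 1))^2 <= eps^2; [d.+1] keeps the
   denominator nonzero. *)
move=> Xu eps e0; pose e := eps / d.+1%:R.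
have epos : 0 < e by rewrite divr_gt0.
have /choice[phi Hphi] i : exists phi, [/\ test_function Omega phi,
    H1 Omega (jet_of phi) & H1norm Omega (u i - jet_of phi) < e].
  by case: (Xu i) => _ /(_ _ epos).
exists phi; split.
- by move=> i; case: (Hphi i).
- move=> i; have [tp Hp _] := Hphi i; split=> // r r0.
  exists (phi i); split=> //; rewrite /vjet_of subrr /H1norm.
  rewrite -/(H1ip Omega 0 0) (semi_ip0l (H1ip_semi oO bO)) ?sqrtr0//.
  exact: (H1_lin_closed oO bO).1.
have ips := H1ip_semi oO bO.
have H i : H1 Omega (u i - jet_of (phi i)).
  have [_ Hp _] := Hphi i; apply: lin_closedB Hp.
    exact: H1_lin_closed.
  by case: (Xu i).
rewrite -[leRHS]ger0_norm ?(ltW e0)// -sqrtr_sqr ler_sqrt ?sqr_ge0//.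
apply: (@le_trans _ _ (\sum_(i < d) e ^+ 2)).
  apply: ler_sum => i _.
  have [_ _ /ltW He] := Hphi i.
  apply: (@le_trans _ _ (H1norm Omega (u i - jet_of (phi i)) ^+ 2)).
    rewrite /H1norm (semi_ip_sqr ips (H i)) lerDr.
    by case: (ip_semi mO) => _ _ _; apply; case: (H i).
  by rewrite ler_pXn2r// nnegrE ?sqrtr_ge0// ltW.
rewrite sumr_const card_ord -mulr_natl /e expr_div_n mulrCA ler_piMr ?sqr_ge0//.
rewrite ler_pdivrMr ?exprn_gt0// mul1r expr2 -natrM ler_nat.
by rewrite mulSn (leq_trans (leqnSn d))// leq_addr.
Qed.

Lemma skew_density (Z : lmodType R) (S : Z -> Prop)
    (t : vjet R d -> Z -> Z -> R) (nrm : Z -> R) C :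
  trilinear (spaceX Omega) S S t ->
  (forall u s s', spaceX Omega u -> S s -> S s' ->
     `|t u s s'| <= C * vnorm1 Omega u * nrm s * nrm s') ->
  (forall phi s, (forall i, test_function Omega (phi i)) -> S s ->
     t (vjet_of phi) s s = 0) ->
  forall u s, spaceX Omega u -> S s -> t u s s = 0.
Proof.
move=> tri tle t0 u s Xu Ss.
apply/eqP; rewrite -normr_le0; apply/ler_addgt0Pr => e e0; rewrite add0r.
pose K := `|C * nrm s * nrm s| + 1.
have K0 : 0 < K by rewrite ltr_pwDr.
have [phi [tphi Xphi uphi]] := spaceX_dense Xu (divr_gt0 e0 K0).
rewrite -[t u s s]subr0 -(t0 _ _ tphi Ss).
rewrite -(trilinearBl tri)//.
apply: le_trans (tle _ _ _ _ Ss Ss) _.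
  exact (lin_closedB (spaceX_lin_closed oO bO) Xu Xphi).
rewrite (_ : _ * nrm s = (C * nrm s * nrm s) * vnorm1 Omega (u - vjet_of phi));
  last by ring.
apply: le_trans (_ : K * (e / K) <= _); last by rewrite mulrC divfK// gt_eqF.
apply: le_trans (_ : `|C * nrm s * nrm s| * vnorm1 Omega (u - vjet_of phi) <= _).
  by rewrite ler_wpM2r ?sqrtr_ge0// ler_norm.
by apply: ler_pM => //; [exact: sqrtr_ge0|rewrite lerDl].
Qed.

End skew_symmetry.

(** * The buoyancy term *)

Section buoyancy_theory.
Context {R : realType} {d : nat} (Omega : set 'rV[R]_d).
Hypothesis oO : open Omega.
Local Notation E := 'rV[R]_d.

Let mO : measurable Omega. Proof. exact: open_measurable_rV. Qed.

Let vertical (T : jet R d) : 'I_d -> E -> R :=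
  fun i x => if i.+1 == d then T.1 x else 0.

Let vertical_L2 T i : H1 Omega T -> L2 Omega (vertical T i).
Proof.
move=> [LT _ _]; rewrite /vertical; case: (i.+1 == d) => //.
exact (L2_lin_closed mO).1.
Qed.

Let L2_field_semi : semi_ip (fun v : 'I_d -> E -> R => forall i, L2 Omega (v i))
  (fun v w => \sum_i ip Omega (v i) (w i)).
Proof.
have [L0 LD] := L2_lin_closed mO.
apply: (semi_ip_sum (L := fun i (v : 'I_d -> E -> R) => v i)) (ip_semi mO) _ _ _.
- split; first by move=> i; exact: L0.
  by move=> c v v' Lv Lv' i; exact (LD c _ _ (Lv i) (Lv' i)).
- by [].
- by move=> i v.
Qed.

Lemma buoyancyB s t v : H1 Omega s -> H1 Omega t -> (forall i, H1 Omega (v i)) ->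
  buoyancy Omega (s - t) v = buoyancy Omega s v - buoyancy Omega t v.
Proof.
move=> Hs Ht Hv; rewrite /buoyancy -sumrB; apply: eq_bigr => i _.
have [Lv _ _] := Hv i.
rewrite -(semi_ipBl (ip_semi mO) (vertical_L2 i Hs) (vertical_L2 i Ht) Lv).
congr ip; apply/funext => x; rewrite !fctE /vertical jetB1.
by case: ifP => // _; rewrite subr0.
Qed.

Lemma buoyancy_le T v : H1 Omega T -> (forall i, H1 Omega (v i)) ->
  `|buoyancy Omega T v| <= norm0 Omega T * vnorm0 Omega v.
Proof.
move=> HT Hv; have Lv i : L2 Omega (v i).1 by case: (Hv i).
apply: le_trans (semi_ip_CS L2_field_semi (fun i => vertical_L2 i HT) Lv) _.
rewrite ler_wpM2r ?sqrtr_ge0// ler_sqrt; last first.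
  by case: (ip_semi mO) => _ _ _; apply; case: HT.
(* Only the last component contributes, so the vertical field has L^2 norm at most that of T. *)
rewrite (eq_bigr (fun i : 'I_d => if i.+1 == d then ip Omega T.1 T.1 else 0));
  last first.
  move=> i _; rewrite /vertical; case: (i.+1 == d) => //.
  exact (semi_ip0l (ip_semi mO) (L2_lin_closed mO).1).
rewrite -big_mkcond/=; have T0 : 0 <= ip Omega T.1 T.1.
  by case: (ip_semi mO) => _ _ _; apply; case: HT.
move: (ip _ _ _) T0 => r r0.
case: (d) => [|n]; first by rewrite big_ord0.
by rewrite (big_pred1 ord_max).
Qed.

End buoyancy_theory.

(** * The concrete scheme as an instance of the abstract iteration *)

Theorem theorem3p4 (R : realType) (d : nat)
  (Omega Gamma1 Gamma2 : set 'rV[R]_d)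
  (nu kappa Ri Cp Cs : R) (f : vjet R d -> R) (g : jet R d -> R)
  (u : vjet R d) (T : jet R d)
  (uk utk : nat -> vjet R d) (Tk Ttk : nat -> jet R d) :
  let X := spaceX Omega in
  let D := spaceD Omega Gamma1 in
  let nX := vnorm1 Omega in
  let nD := norm1 Omega in
  let mu := lebesgue_rV R d in
  let alpha1 := Cs * nu^-1 * M1 Omega Gamma1 nu kappa Ri f g Cp in
  let alpha2 := Cs * kappa^-1 * M2 Omega Gamma1 kappa g in
  let beta k := alpha1 + alpha2 +
    Cs * (alpha1 + alpha2) * (kappa^-1 + nu^-1) * nX (u - uk k) in
  let Err k := nX (u - uk k) + nD (T - Tk k) in
  (* the domain *)
  (d = 2%N \/ d = 3%N) ->
  open Omega -> connected Omega -> bounded_set Omega ->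
  Gamma1 `|` Gamma2 = bd Omega ->
  surface (Gamma1 `&` Gamma2) = 0%E -> (0 < surface Gamma1)%E ->
  (* Omega is regular enough for the trilinear forms to be defined, ... *)
  (forall u v w, X u -> X v -> X w ->
     mu.-integrable Omega (EFin \o convection u v w) /\
     mu.-integrable Omega (EFin \o div_term u v w)) ->
  (forall u s t, X u -> D s -> D t ->
     mu.-integrable Omega (EFin \o hconvection u s t) /\
     mu.-integrable Omega (EFin \o hdiv_term u s t)) ->
  (* ... for the Poincare inequality, ... *)
  0 < Cp ->
  (forall z, X z -> vnorm0 Omega z <= Cp * nX z) ->
  (forall z, D z -> norm0 Omega z <= Cp * nD z) ->
  (* ... and for the bounds on the trilinear forms *)
  0 < Cs ->
  (forall u v w, X u -> X v -> X w ->
     `|b Omega u v w| <= Cs * nX u * nX v * nX w) ->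
  (forall u s t, X u -> D s -> D t ->
     `|bh Omega u s t| <= Cs * nX u * nD s * nD t) ->
  (* the data *)
  0 < nu -> 0 < kappa -> 0 < Ri ->
  is_dual X nX f -> is_dual D nD g ->
  (* the solution and the iterates *)
  flow_solution Omega Gamma1 nu kappa Ri f g u T ->
  X (uk 0%N) -> D (Tk 0%N) ->
  (forall k, picard_step Omega Gamma1 nu kappa Ri f g
               (uk k) (utk k.+1) (Ttk k.+1)) ->
  (forall k, newton_step Omega Gamma1 nu kappa Ri f g
               (utk k.+1) (Ttk k.+1) (uk k.+1) (Tk k.+1)) ->
  (* the smallness conditions *)
  Ri * Cp ^+ 2 * nu^-1 < 1 ->
  (forall k, beta k < 1) ->
  forall k0 : nat,
  (1 - Num.max (beta k0) (Ri * Cp ^+ 2 * nu^-1))^-1 * Cs *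
    (alpha1 + alpha2) ^+ 2 * (nu^-1 + kappa^-1) * nX (u - uk k0) < 1 ->
  Err k @[k --> \oo] --> 0 /\
  exists C : R, forall k, (k0 <= k)%N -> Err k.+1 <= C * Err k ^+ 2.

Proof.
move=> X D nX nD mu alpha1 alpha2 beta Err dim oO _ bO _ _ _ bint bhint.
move=> Cp0 poiX poiD Cs0 ble bhle nu0 kappa0 Ri0 fX gD sol X0 _ pic newt.
move=> lam1 beta1 k0 small.
have mO : measurable Omega by exact: open_measurable_rV.
have Xlin : lin_closed X by exact: spaceX_lin_closed.
have Dlin : lin_closed D.
  by apply: spaceD_lin_closed => //; case: dim => ->.
have Vlin : lin_closed (spaceV Omega) by exact: spaceV_lin_closed.
have VX v : spaceV Omega v -> X v by case.
have XH v : X v -> forall i, H1 Omega (v i) by exact: spaceX_H1.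
have DH s : D s -> H1 Omega s by case.
have aX : semi_ip X (vgrad_ip Omega).
  exact: semi_ip_sub (vgrad_ip_semi oO bO) Xlin XH.
have aD : semi_ip D (grad_ip Omega).
  exact: semi_ip_sub (grad_ip_semi oO bO) Dlin DH.
have btri : trilinear X X X (@b R d Omega) by exact: b_trilinear.
have bhtri : trilinear X D D (@bh R d Omega) by exact: bh_trilinear.
have bskew v w : X v -> X w -> b Omega v w w = 0.
  apply: (skew_density oO bO btri ble) => phi s tphi.
  exact: b_vjet_of_skew.
have bhskew v s : X v -> D s -> bh Omega v s s = 0.
  apply: (skew_density oO bO bhtri bhle) => phi t tphi Dt.
  apply: (bh_vjet_of_skew oO bO tphi (DH _ Dt)).
  exact: spaceD_approximable Dt.
have buoB s t v : D s -> D t -> X v ->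
    buoyancy Omega (s - t) v = buoyancy Omega s v - buoyancy Omega t v.
  by move=> /DH Hs /DH Ht /XH; exact: buoyancyB.
have buole s v : D s -> X v ->
    `|buoyancy Omega s v| <= Cp ^+ 2 * nD s * nX v.
  move=> Ds Xv; apply: le_trans (buoyancy_le oO (DH _ Ds) (XH _ Xv)) _.
  (* One factor [Cp] comes from the Poincare inequality in D, the other from the one in X. *)
  apply: le_trans (_ : (Cp * nD s) * (Cp * nX v) <= _).
    by apply: ler_pM; rewrite ?sqrtr_ge0//; [exact: poiD|exact: poiX].
  by rewrite le_eqVlt; apply/orP; left; apply/eqP; ring.
(* The dual norm of f in [M1] is taken over V, so f is restricted from X. *)
have fV : is_dual (spaceV Omega) nX f.
  case: fX => fl [C fC]; split; last by exists C => z /VX /fC.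
  by move=> a z z' /VX Xz /VX; exact: fl.
(* The three systems are the abstract ones by conversion, [flow_solution] being the Picard system
   transported by u itself. *)
exact (picard_newton_quadratic aX aD Vlin VX btri bhtri ble bhle bskew bhskew
  buoB buole Cs0 Cp0 nu0 kappa0 Ri0 fV gD sol X0 pic newt lam1 beta1 small).
Qed.
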